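(* Suppose that $f(z)=h(z)+\overline{g(z)}=\sum_{k=0}^\infty a_k z^k+\overline{\sum_{k=1}^\infty b_k z^k}$ is a harmonic mapping of the unit disk $\mathbb{D}=\{z\in\mathbb{C}:|z|<1\}$, where $h$ and $g$ are analytic in $\mathbb{D}$, $h$ is bounded with $\|h\|_\infty=1$, and $|g'(z)|\le |h'(z)|$ for all $z\in\mathbb{D}$. Then, for every $z\in\mathbb{D}$ with $|z|=r$, $$|h(z)|^2+\sum_{k=1}^\infty(|a_k|^2+|b_k|^2)r^{2k}\le 1\quad\text{for } r\le r_0,$$ where $r_0=\sqrt{5/(9+4\sqrt5)}\approx 0.527864$ is the unique positive root of the equation $$(10+6r^2)^{3/2}+144r^2-80=0$$ in the interval $(0,1/\sqrt2)$. The number $r_0$ is the best possible.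
   Context: $\|h\|_\infty=\sup_{z\in\mathbb{D}}|h(z)|$. ''Best possible'' means that if $r_0$ is replaced by any larger number, the inequality fails for some $f$ satisfying the hypotheses and some $z$ with $|z|=r$ in the corresponding range. *)

(* Defs.v *)
From Stdlib Require Export Reals.
From Coquelicot Require Export Coquelicot.
Open Scope R_scope.

Definition unit_disk (z : C) : Prop := Cmod z < 1.

Definition analytic_on_disk (h : C -> C) : Prop :=
  forall z : C, unit_disk z ->
    @ex_derive C_AbsRing C_NormedModule h z.

(* The value lies in [Rbar], so [sup_norm h = Finite 1] includes boundedness
   of [h] on the disk. *)
Definition sup_norm (h : C -> C) : Rbar :=
  Lub_Rbar (fun x : R => exists z : C, unit_disk z /\ x = Cmod (h z)).

(* Functions are total on [C]; only their values on the open disk matter.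
   The series of [g] starts at exponent 1, so [g 0 = 0], and [b 0] is not
   used here or in [coeff_term]. *)
Definition harmonic_mapping_on_disk
    (f h g : C -> C) (a b : nat -> C) : Prop :=
  analytic_on_disk h /\
  analytic_on_disk g /\
  forall z : C, unit_disk z ->
    f z = (h z + Cconj (g z))%C /\
    @is_series C_AbsRing C_NormedModule
      (fun k : nat => (a k * z ^ k)%C) (h z) /\
    @is_series C_AbsRing C_NormedModule
      (fun k : nat => (b (S k) * z ^ (S k))%C) (g z).

Definition admissible (f h g : C -> C) (a b : nat -> C) : Prop :=
  harmonic_mapping_on_disk f h g a b /\
  sup_norm h = Finite 1 /\
  forall z : C, unit_disk z -> Cmod (C_derive g z) <= Cmod (C_derive h z).

(* Indexed from 0: [coeff_term a b r k] is the summand of index [k + 1]. *)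
Definition coeff_term (a b : nat -> C) (r : R) (k : nat) : R :=
  (Cmod (a (S k)) ^ 2 + Cmod (b (S k)) ^ 2) * r ^ (2 * S k).

Definition r0 : R := sqrt (5 / (9 + 4 * sqrt 5)).

Definition radius_equation (r : R) : Prop :=
  Rpower (10 + 6 * r ^ 2) (3 / 2) + 144 * r ^ 2 - 80 = 0.

(* Main.v *)
Require Import Defs.
From Stdlib Require Import Lra Lia Psatz Compare_dec.

(** Write [r = |z|], [al = |a 0|], and let [S] and [T] be the sums over [k >= 1] of
    [|a k| ^ 2 r ^ (2 k)] and [|b k| ^ 2 r ^ (2 k)].

    Three estimates carry the inequality. First, [T <= S] ([dominated_coeffs]):
    by Parseval, [|g'| <= |h'|] on the circle of radius [sqrt x] compares the sums of
    [k ^ 2 |b k| ^ 2 x ^ k] and [k ^ 2 |a k| ^ 2 x ^ k], and integrating twice in [x]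
    removes the weights. Secondly, Schwarz-Pick at the centre,
    [|h z - a 0| <= |z| |1 - Cconj (a 0) * h z|] ([schwarz_pick]), yields
    [|h z| <= (al + r) / (1 + al r)] ([growth_bound]). Thirdly, the same pointwise
    inequality, squared and averaged over the circle, yields
    [S <= r ^ 2 (1 - al ^ 2) ^ 2 / (1 - al ^ 2 r ^ 2)] ([coeff_sum_bound]).
    Hence [1 - |h z| ^ 2 - S - T] is at least a nonnegative multiple of
    [1 - t + 2 t ^ 2 + 2 t ^ 3 - r ^ 2 (3 + t)] with [t = al r]
    ([extremal_inequality]). At [r = r0 = 5 - 2 sqrt 5] this cubic has the double root
    [t = sqrt 5 - 2] and is nonnegative for [t >= 0] ([cubic_factor]); it decreases in [r].

    For sharpness, [h z = (al + z) / (1 + al z)] and [g = h - al] turn the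
    estimates into equalities at positive [z], and [al = / sqrt 5] puts
    [t] at the double root when [r = r0]; past [r0] the cubic is negative ([cubic_lt_0]).

    The complex analysis rests on means over circles, defined as limits of averages over
    roots of unity. Schwarz-Pick is obtained from them by a Hilbert space argument:
    multiplication by [h] is a contraction for the mean square norm, and so is its compression
    to the span of the constants and the Szego kernel at [zeta]; that compression is a
    triangular matrix with diagonal [h 0], [h zeta], and contractivity of this 2 by 2 matrix
    is the claim. *)

(** * Complex series *)

(** Series and partial sums with values in the field [C] itself, so that ring tactics see its operations. *)
Definition Cseries (c : nat -> C) (l : C) : Prop :=
  @is_series C_AbsRing C_NormedModule c l.

Definition Csum (u : nat -> C) (n : nat) : C :=
  @sum_n (NormedModule.AbelianMonoid C_AbsRing C_NormedModule) u n.

Definition Ccvg (u : nat -> C) (l : C) : Prop :=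
  forall eps : R, 0 < eps ->
    exists N : nat, forall n : nat, (N <= n)%nat -> Cmod (u n - l) < eps.

Lemma Csum_0 (u : nat -> C) : Csum u 0 = u 0%nat.
Proof. unfold Csum; apply (@sum_O (NormedModule.AbelianMonoid C_AbsRing C_NormedModule)). Qed.

Lemma Csum_S (u : nat -> C) (n : nat) : Csum u (S n) = (Csum u n + u (S n))%C.
Proof. unfold Csum; apply (@sum_Sn (NormedModule.AbelianMonoid C_AbsRing C_NormedModule)). Qed.

Lemma Csum_ext (u v : nat -> C) (n : nat) :
  (forall k, (k <= n)%nat -> u k = v k) -> Csum u n = Csum v n.
Proof.
  induction n as [|n IH]; intros H.
  - rewrite !Csum_0; apply H; lia.
  - rewrite !Csum_S, IH by (intros; apply H; lia). rewrite (H (S n)) by lia. reflexivity.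
Qed.

Lemma Csum_plus (u v : nat -> C) (n : nat) :
  Csum (fun k => (u k + v k)%C) n = (Csum u n + Csum v n)%C.
Proof.
  induction n as [|n IH]; [rewrite !Csum_0 | rewrite !Csum_S, IH; ring].
  reflexivity.
Qed.

Lemma Csum_scal (c : C) (u : nat -> C) (n : nat) :
  Csum (fun k => (c * u k)%C) n = (c * Csum u n)%C.
Proof.
  induction n as [|n IH]; [rewrite !Csum_0 | rewrite !Csum_S, IH; ring].
  reflexivity.
Qed.

Lemma Csum_conj (u : nat -> C) (n : nat) :
  Csum (fun k => Cconj (u k)) n = Cconj (Csum u n).
Proof.
  induction n as [|n IH]; [rewrite !Csum_0; reflexivity |].
  rewrite !Csum_S, IH, Cplus_conj; reflexivity.
Qed.

Lemma Cmod_Csum_le (u : nat -> C) (B : nat -> R) (n : nat) :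
  (forall k, Cmod (u k) <= B k) -> Cmod (Csum u n) <= sum_n B n.
Proof.
  intros H; induction n as [|n IH].
  - rewrite Csum_0, sum_O; apply H.
  - rewrite Csum_S, sum_Sn.
    eapply Rle_trans; [apply Cmod_triangle |].
    apply Rplus_le_compat; [exact IH | apply H].
Qed.

Lemma Cmod_minus_sym (x y : C) : Cmod (x - y) = Cmod (y - x).
Proof. rewrite <- (Cmod_opp (x - y)). f_equal; ring. Qed.

Lemma Ccvg_filterlim (u : nat -> C) (l : C) :
  Ccvg u l <->
  filterlim u eventually (@locally (NormedModule.UniformSpace C_AbsRing C_NormedModule) l).
Proof.
  split.
  - intros H. apply (@filterlim_locally_ball_norm C_AbsRing nat C_NormedModule); [apply _|].
    intros eps. destruct (H eps (cond_pos eps)) as [N HN].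
    exists N. intros n Hn. exact (HN n Hn).
  - intros H eps He.
    assert (H' := proj1 (@filterlim_locally_ball_norm C_AbsRing nat C_NormedModule _ _ u l) H (mkposreal eps He)).
    destruct H' as [N HN]. exists N. intros n Hn. exact (HN n Hn).
Qed.

Lemma Cseries_Ccvg (c : nat -> C) (l : C) : Cseries c l <-> Ccvg (Csum c) l.
Proof. symmetry; apply (Ccvg_filterlim (Csum c)). Qed.

Lemma Ccvg_ext_from (N : nat) (u v : nat -> C) (l : C) :
  (forall n, (N <= n)%nat -> u n = v n) -> Ccvg u l -> Ccvg v l.
Proof.
  intros H Hu eps He. destruct (Hu eps He) as [M HM].
  exists (max M N). intros n Hn. rewrite <- H by lia. apply HM; lia.
Qed.

Lemma Ccvg_const (l : C) : Ccvg (fun _ => l) l.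
Proof.
  intros eps He; exists 0%nat; intros n _.
  replace (l - l)%C with (RtoC 0) by ring. rewrite Cmod_0; exact He.
Qed.

Lemma Ccvg_plus (u v : nat -> C) (l m : C) :
  Ccvg u l -> Ccvg v m -> Ccvg (fun n => (u n + v n)%C) (l + m)%C.
Proof.
  intros Hu Hv eps He.
  destruct (Hu (eps / 2)) as [N HN]; [lra |].
  destruct (Hv (eps / 2)) as [M HM]; [lra |].
  exists (max N M); intros n Hn.
  replace (u n + v n - (l + m))%C with ((u n - l) + (v n - m))%C by ring.
  eapply Rle_lt_trans; [apply Cmod_triangle |].
  specialize (HN n ltac:(lia)); specialize (HM n ltac:(lia)); lra.
Qed.

Lemma Ccvg_scal (c : C) (u : nat -> C) (l : C) :
  Ccvg u l -> Ccvg (fun n => (c * u n)%C) (c * l)%C.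
Proof.
  intros Hu eps He. assert (Hc := Cmod_ge_0 c).
  destruct (Hu (eps / (Cmod c + 1))) as [N HN].
  { apply Rdiv_lt_0_compat; lra. }
  exists N; intros n Hn.
  replace (c * u n - c * l)%C with (c * (u n - l))%C by ring.
  rewrite Cmod_mult. specialize (HN n Hn).
  apply Rle_lt_trans with (Cmod c * (eps / (Cmod c + 1))).
  - apply Rmult_le_compat_l; lra.
  - apply Rmult_lt_reg_r with (Cmod c + 1); [lra |].
    field_simplify; [nra | lra].
Qed.

Lemma Ccvg_conj (u : nat -> C) (l : C) :
  Ccvg u l -> Ccvg (fun n => Cconj (u n)) (Cconj l).
Proof.
  intros Hu eps He. destruct (Hu eps He) as [N HN].
  exists N; intros n Hn. rewrite <- Cminus_conj, Cmod_conj. apply HN, Hn.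
Qed.

Lemma Ccvg_unique (u : nat -> C) (l m : C) : Ccvg u l -> Ccvg u m -> l = m.
Proof.
  intros Hl Hm.
  assert (H : forall eps, 0 < eps -> Cmod (l - m) < eps).
  { intros eps He.
    destruct (Hl (eps / 2)) as [N HN]; [lra |].
    destruct (Hm (eps / 2)) as [M HM]; [lra |].
    specialize (HN (max N M) ltac:(lia)); specialize (HM (max N M) ltac:(lia)).
    replace (l - m)%C with ((l - u (max N M)) + (u (max N M) - m))%C by ring.
    eapply Rle_lt_trans; [apply Cmod_triangle |].
    rewrite (Cmod_minus_sym l). lra. }
  assert (H0 : Cmod (l - m) = 0).
  { destruct (Cmod_ge_0 (l - m)) as [Hp | Hp]; [| lra].
    specialize (H _ Hp); lra. }
  apply Cmod_eq_0 in H0.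
  replace l with (l - m + m)%C by ring. rewrite H0; ring.
Qed.

(** Inequalities between means are obtained by averaging pointwise ones; this is the step to the limit. *)
Lemma Ccvg_Re_ge_0 (u : nat -> C) (l : C) :
  (forall n, 0 <= Re (u n)) -> Ccvg u l -> 0 <= Re l.
Proof.
  intros H Hu. destruct (Rle_or_lt 0 (Re l)) as [Hl | Hl]; [exact Hl |].
  exfalso. destruct (Hu (- Re l)) as [N HN]; [lra |].
  specialize (HN N ltac:(lia)).
  assert (Hr := re_le_Cmod (u N - l)). unfold Rabs in Hr.
  specialize (H N).
  replace (Re (u N - l)) with (Re (u N) - Re l) in Hr by reflexivity.
  destruct (Rcase_abs _); lra.
Qed.

Lemma Ccvg_Cmod_le (u : nat -> C) (l : C) (B : R) :
  (forall n, Cmod (u n) <= B) -> Ccvg u l -> Cmod l <= B.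
Proof.
  intros H Hu. apply Rnot_lt_le; intros Hl.
  destruct (Hu (Cmod l - B)) as [N HN]; [lra |].
  specialize (HN N ltac:(lia)). specialize (H N).
  assert (Ht := Cmod_triangle (l - u N) (u N)).
  replace (l - u N + u N)%C with l in Ht by ring.
  rewrite Cmod_minus_sym in Ht. lra.
Qed.

Lemma Cseries_incr (c : nat -> C) (l : C) (n : nat) :
  Cseries c l -> Cseries (fun k => c (S n + k)%nat) (l - Csum c n)%C.
Proof.
  intros H. apply (is_series_incr_n c (S n)); [lia |].
  change (Cseries c (l - Csum c n + Csum c n)%C).
  replace (l - Csum c n + Csum c n)%C with l by ring. exact H.
Qed.

Lemma sum_n_le_Series (B : nat -> R) (n : nat) :
  (forall k, 0 <= B k) -> ex_series B -> sum_n B n <= Series B.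
Proof.
  intros HB HS. destruct HS as [S HS]. rewrite (is_series_unique _ _ HS).
  apply (is_lim_seq_incr_compare (sum_n B)); [exact HS |].
  intros k. rewrite sum_Sn. unfold plus; simpl. specialize (HB (Datatypes.S k)); lra.
Qed.

Lemma Cseries_Cmod_le (c : nat -> C) (l : C) (B : nat -> R) :
  (forall k, Cmod (c k) <= B k) -> ex_series B -> Cseries c l ->
  Cmod l <= Series B.
Proof.
  intros Hc HB Hl.
  assert (HB0 : forall k, 0 <= B k).
  { intros k; eapply Rle_trans; [apply Cmod_ge_0 | apply Hc]. }
  apply Ccvg_Cmod_le with (Csum c); [| apply Cseries_Ccvg, Hl].
  intros n. eapply Rle_trans; [apply Cmod_Csum_le, Hc |].
  apply sum_n_le_Series; assumption.
Qed.

(** The error bound of the Weierstrass M-test: uniform in the terms, as it only sees their majorants. *)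
Lemma Cseries_tail_le (c : nat -> C) (l : C) (B : nat -> R) (n : nat) :
  (forall k, Cmod (c k) <= B k) -> ex_series B -> Cseries c l ->
  Cmod (l - Csum c n) <= Series B - sum_n B n.
Proof.
  intros Hc HB Hl.
  replace (Series B - sum_n B n) with (Series (fun k => B (S n + k)%nat)).
  - apply (Cseries_Cmod_le (fun k => c (S n + k)%nat)).
    + intros k; apply Hc.
    + apply (proj1 (ex_series_incr_n B (S n))), HB.
    + apply Cseries_incr, Hl.
  - rewrite (Series_incr_n B (S n)) by (lia || assumption).
    simpl pred. rewrite sum_n_Reals. ring.
Qed.

Lemma ex_Cseries_bound (c : nat -> C) (B : nat -> R) :
  (forall k, Cmod (c k) <= B k) -> ex_series B -> exists l : C, Cseries c l.
Proof.
  intros Hc HB.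
  exact (@ex_series_le C_AbsRing C_CompleteNormedModule c B Hc HB).
Qed.

Lemma Cseries_scal (k : C) (c : nat -> C) (l : C) :
  Cseries c l -> Cseries (fun n => (k * c n)%C) (k * l)%C.
Proof. intros H; apply (is_series_scal k c l H). Qed.

Lemma Cseries_ext (c d : nat -> C) (l : C) :
  (forall n, c n = d n) -> Cseries c l -> Cseries d l.
Proof. apply is_series_ext. Qed.

Lemma Cseries_conj (c : nat -> C) (l : C) :
  Cseries c l -> Cseries (fun n => Cconj (c n)) (Cconj l).
Proof.
  rewrite !Cseries_Ccvg; intros H. apply Ccvg_conj in H.
  revert H; apply (Ccvg_ext_from 0); intros n _; symmetry; apply Csum_conj.
Qed.

Lemma Cseries_single (m : nat) (v : C) :
  Cseries (fun n => if Nat.eq_dec n m then v else RtoC 0) v.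
Proof.
  apply Cseries_Ccvg.
  apply (Ccvg_ext_from m (fun _ => v)); [| apply Ccvg_const].
  assert (H : forall n, Csum (fun n => if Nat.eq_dec n m then v else RtoC 0) n
                        = if le_dec m n then v else RtoC 0).
  { induction n as [|n IH].
    - rewrite Csum_0. destruct (Nat.eq_dec 0 m), (le_dec m 0); try reflexivity; lia.
    - rewrite Csum_S, IH.
      destruct (Nat.eq_dec (S n) m), (le_dec m n), (le_dec m (S n)); try lia; ring. }
  intros n Hn. rewrite H. destruct (le_dec m n); [reflexivity | lia].
Qed.

Lemma Cseries_unique (c : nat -> C) (l m : C) : Cseries c l -> Cseries c m -> l = m.
Proof. rewrite !Cseries_Ccvg; apply Ccvg_unique. Qed.

Lemma Cseries_geom (q : C) : Cmod q < 1 -> Cseries (fun n => (q ^ n)%C) (/ (1 - q))%C.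
Proof.
  intros Hq.
  assert (Hq1 : (1 - q)%C <> RtoC 0).
  { intros E. assert (E' : q = RtoC 1) by (replace q with (1 - (1 - q))%C by ring; rewrite E; ring).
    rewrite E', Cmod_1 in Hq; lra. }
  destruct (ex_Cseries_bound (fun n => (q ^ n)%C) (fun n => Cmod q ^ n)) as [l Hl].
  - intros k; rewrite Cmod_pow; lra.
  - apply ex_series_geom. rewrite Rabs_pos_eq by apply Cmod_ge_0. exact Hq.
  - assert (H1 := Cseries_incr _ _ 0 Hl). rewrite Csum_0 in H1.
    assert (H2 := Cseries_scal q _ _ Hl).
    assert (E : (l - q ^ 0)%C = (q * l)%C).
    { apply (Cseries_unique (fun n => (q * q ^ n)%C)); [| exact H2].
      revert H1; apply Cseries_ext; intros n; reflexivity. }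
    replace (/ (1 - q))%C with l; [exact Hl |].
    assert (E2 : ((1 - q) * l = 1)%C).
    { simpl in E. replace ((1 - q) * l)%C with (l - q * l)%C by ring. rewrite <- E. ring. }
    transitivity (((1 - q) * l) / (1 - q))%C; [field; exact Hq1 |].
    rewrite E2. field. exact Hq1.
Qed.

(** * Means over circles *)

Definition cis (x : R) : C := (cos x, sin x).

Lemma Cmod_cis (x : R) : Cmod (cis x) = 1.
Proof.
  unfold Cmod, cis; simpl fst; simpl snd.
  replace (cos x ^ 2 + sin x ^ 2) with 1; [apply sqrt_1 |].
  generalize (sin2_cos2 x); unfold Rsqr; nra.
Qed.

Lemma cis_plus (x y : R) : cis (x + y) = (cis x * cis y)%C.
Proof.
  unfold cis, Cmult; simpl. rewrite cos_plus, sin_plus.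
  f_equal; ring.
Qed.

Lemma cis_pow (x : R) (n : nat) : (cis x ^ n)%C = cis (INR n * x).
Proof.
  induction n as [|n IH].
  - simpl. unfold cis. rewrite Rmult_0_l, cos_0, sin_0. reflexivity.
  - rewrite Cpow_S, IH, <- cis_plus, S_INR. f_equal; ring.
Qed.

Lemma cis_neq_1 (x : R) : 0 < x < 2 * PI -> cis x <> RtoC 1.
Proof.
  intros Hx E. assert (Ec : cos x = 1) by (injection E; auto).
  assert (H := cos_2a_sin (x / 2)). replace (2 * (x / 2)) with x in H by field.
  assert (Hs : 0 < sin (x / 2)) by (apply sin_gt_0; lra).
  rewrite Ec in H. nra.
Qed.

Definition circle_point (rho : R) (N j : nat) : C :=
  (rho * cis (2 * PI * INR j / INR (S N)))%C.

Lemma Cmod_circle_point (rho : R) (N j : nat) :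
  0 <= rho -> Cmod (circle_point rho N j) = rho.
Proof.
  intros H. unfold circle_point. rewrite Cmod_mult, Cmod_cis, Cmod_R, Rabs_pos_eq by exact H.
  ring.
Qed.

(** Integrals over a circle are replaced by averages over the [N + 1]-st
    roots of unity scaled by [rho]: orthogonality of the monomials then
    is the vanishing of a finite geometric sum. *)
Definition circle_avg (rho : R) (F : C -> C) (N : nat) : C :=
  (RtoC (/ INR (S N)) * Csum (fun j => F (circle_point rho N j)) N)%C.

(** The mean of [F] over the circle of radius [rho]; for continuous [F] it is the
    integral against normalised arc length. *)
Definition has_mean (rho : R) (F : C -> C) (L : C) : Prop :=
  Ccvg (circle_avg rho F) L.

Lemma circle_avg_plus rho F G N :
  circle_avg rho (fun z => F z + G z)%C N = (circle_avg rho F N + circle_avg rho G N)%C.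
Proof. unfold circle_avg. rewrite Csum_plus. ring. Qed.

Lemma circle_avg_scal rho c F N :
  circle_avg rho (fun z => c * F z)%C N = (c * circle_avg rho F N)%C.
Proof. unfold circle_avg. rewrite Csum_scal. ring. Qed.

Lemma circle_avg_ext rho F G N :
  0 <= rho -> (forall z, Cmod z = rho -> F z = G z) ->
  circle_avg rho F N = circle_avg rho G N.
Proof.
  intros Hr H. unfold circle_avg. f_equal. apply Csum_ext. intros j _.
  apply H, Cmod_circle_point, Hr.
Qed.

Lemma INR_S_neq_0 (N : nat) : RtoC (INR (S N)) <> RtoC 0.
Proof. intros E; apply RtoC_inj in E. revert E; apply not_0_INR; lia. Qed.

Lemma Cmod_circle_avg_le rho F B N :
  0 <= rho -> (forall z, Cmod z = rho -> Cmod (F z) <= B) ->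
  Cmod (circle_avg rho F N) <= B.
Proof.
  intros Hr H. unfold circle_avg.
  assert (HN : 0 < INR (S N)) by (apply lt_0_INR; lia).
  rewrite Cmod_mult, Cmod_R, Rabs_pos_eq
    by (left; apply Rinv_0_lt_compat, HN).
  apply Rmult_le_reg_l with (INR (S N)); [exact HN |].
  rewrite <- Rmult_assoc, Rinv_r, Rmult_1_l by lra.
  rewrite <- sum_n_const. apply Cmod_Csum_le.
  intros k; apply H, Cmod_circle_point, Hr.
Qed.

Lemma has_mean_ext rho F G L :
  0 <= rho -> (forall z, Cmod z = rho -> F z = G z) ->
  has_mean rho F L -> has_mean rho G L.
Proof.
  intros Hr H. apply (Ccvg_ext_from 0). intros n _. apply circle_avg_ext; assumption.
Qed.

Lemma has_mean_plus rho F G L M :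
  has_mean rho F L -> has_mean rho G M -> has_mean rho (fun z => F z + G z)%C (L + M)%C.
Proof.
  intros HF HG. generalize (Ccvg_plus _ _ _ _ HF HG).
  apply (Ccvg_ext_from 0). intros n _. symmetry; apply circle_avg_plus.
Qed.

Lemma has_mean_scal rho c F L :
  has_mean rho F L -> has_mean rho (fun z => c * F z)%C (c * L)%C.
Proof.
  intros HF. generalize (Ccvg_scal c _ _ HF).
  apply (Ccvg_ext_from 0). intros n _. symmetry; apply circle_avg_scal.
Qed.

Lemma has_mean_conj rho F L :
  has_mean rho F L -> has_mean rho (fun z => Cconj (F z)) (Cconj L).
Proof.
  intros HF. generalize (Ccvg_conj _ _ HF).
  apply (Ccvg_ext_from 0). intros n _. unfold circle_avg.
  rewrite Cmult_conj, Csum_conj. f_equal.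
  apply injective_projections; simpl; ring.
Qed.

Lemma has_mean_const rho c : has_mean rho (fun _ => c) c.
Proof.
  generalize (Ccvg_const c). apply (Ccvg_ext_from 0). intros n _.
  unfold circle_avg.
  assert (H : Csum (fun _ => c) n = (INR (S n) * c)%C).
  { induction n as [|n IH].
    - rewrite Csum_0. simpl. ring.
    - rewrite Csum_S, IH, (S_INR (S n)), RtoC_plus. ring. }
  rewrite H, RtoC_inv by (apply not_0_INR; lia). field. apply INR_S_neq_0.
Qed.

Lemma has_mean_Re_ge_0 rho F L :
  0 <= rho -> (forall z, Cmod z = rho -> 0 <= Re (F z)) -> has_mean rho F L -> 0 <= Re L.
Proof.
  intros Hr H. apply Ccvg_Re_ge_0. intros n. unfold circle_avg.
  assert (Hn : 0 < / INR (S n)) by (apply Rinv_0_lt_compat, lt_0_INR; lia).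
  assert (HS : forall m, 0 <= Re (Csum (fun j => F (circle_point rho n j)) m)).
  { induction m as [|m IH].
    - rewrite Csum_0. apply H, Cmod_circle_point, Hr.
    - rewrite Csum_S. unfold Re, Cplus in *; simpl.
      apply Rplus_le_le_0_compat; [exact IH | apply H, Cmod_circle_point, Hr]. }
  specialize (HS n). revert HS. generalize (Csum (fun j => F (circle_point rho n j)) n).
  intros [x y]; unfold Re, Cmult, RtoC; cbn -[INR Rinv]. intros. nra.
Qed.

Lemma circle_avg_Csum rho (phi : nat -> C -> C) n N :
  circle_avg rho (fun z => Csum (fun m => phi m z) n) N
  = Csum (fun m => circle_avg rho (phi m) N) n.
Proof.
  induction n as [|n IH].
  - rewrite Csum_0. unfold circle_avg. f_equal. apply Csum_ext; intros; apply Csum_0.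
  - rewrite Csum_S, <- IH, <- circle_avg_plus. unfold circle_avg. f_equal.
    apply Csum_ext; intros; apply Csum_S.
Qed.

Lemma Csum_Ccvg (u : nat -> nat -> C) (mu : nat -> C) n :
  (forall m, Ccvg (u m) (mu m)) -> Ccvg (fun N => Csum (fun m => u m N) n) (Csum mu n).
Proof.
  intros H. induction n as [|n IH].
  - rewrite Csum_0. generalize (H 0%nat). apply (Ccvg_ext_from 0).
    intros N _. symmetry; apply Csum_0.
  - rewrite Csum_S. generalize (Ccvg_plus _ _ _ _ IH (H (S n))).
    apply (Ccvg_ext_from 0). intros N _. symmetry; apply (Csum_S (fun m => u m N)).
Qed.

(** Averaging does not increase the supremum over the circle, so the tail of a
    normally convergent series has small averages, uniformly in [N]; only finitely many terms
    remain, and for those the limit in [N] may be taken separately. *)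
Lemma has_mean_series rho (phi : nat -> C -> C) (Phi : C -> C) (B : nat -> R) mu L :
  0 <= rho ->
  (forall m z, Cmod z = rho -> Cmod (phi m z) <= B m) -> ex_series B ->
  (forall z, Cmod z = rho -> Cseries (fun m => phi m z) (Phi z)) ->
  (forall m, has_mean rho (phi m) (mu m)) -> Cseries mu L ->
  has_mean rho Phi L.
Proof.
  intros Hr HB HS HPhi Hmu HL eps He.
  apply Cseries_Ccvg in HL.
  destruct (HL (eps / 3)) as [N1 HN1]; [lra |].
  assert (HB' : is_lim_seq (sum_n B) (Series B)) by exact (Series_correct _ HS).
  apply is_lim_seq_spec in HB'.
  destruct (HB' (mkposreal (eps / 3) ltac:(lra))) as [N2 HN2]. simpl in HN2.
  set (n := max N1 N2).
  destruct (Csum_Ccvg (fun m => circle_avg rho (phi m)) mu n Hmu (eps / 3)) as [N3 HN3]; [lra |].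
  exists N3. intros N HN.
  specialize (HN1 n ltac:(lia)); specialize (HN2 n ltac:(lia)); specialize (HN3 N HN).
  replace (circle_avg rho Phi N - L)%C with
    (circle_avg rho (fun z => Phi z + (-1) * Csum (fun m => phi m z) n) N
     + (Csum (fun m => circle_avg rho (phi m) N) n - Csum mu n) + (Csum mu n - L))%C
    by (rewrite circle_avg_plus, circle_avg_scal, circle_avg_Csum; ring).
  eapply Rle_lt_trans; [apply Cmod_triangle |].
  eapply Rle_lt_trans; [apply Rplus_le_compat_r, Cmod_triangle |].
  assert (H1 : Cmod (circle_avg rho (fun z => Phi z + (-1) * Csum (fun m => phi m z) n) N)%C
               <= Series B - sum_n B n).
  { apply Cmod_circle_avg_le; [exact Hr |]. intros z Hz.
    replace (Phi z + (-1) * Csum (fun m => phi m z) n)%C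
      with (Phi z - Csum (fun m => phi m z) n)%C by ring.
    apply Cseries_tail_le; auto. }
  apply Rabs_def2 in HN2. lra.
Qed.

(** With [w] the root of unity [exp (2 i pi (n + 1) / (N + 1))], the average is a
    multiple of the sum of [w ^ j] over a full period, which vanishes as soon as [w] differs
    from 1, that is once [N] exceeds [n]. *)
Lemma has_mean_pow rho n : 0 <= rho -> has_mean rho (fun z => z ^ S n)%C 0.
Proof.
  intros Hr. apply (Ccvg_ext_from (S n) (fun _ => RtoC 0)); [| apply Ccvg_const].
  intros N HN. unfold circle_avg.
  set (w := cis (2 * PI * INR (S n) / INR (S N))).
  assert (HN0 : 0 < INR (S N)) by (apply lt_0_INR; lia).
  assert (Hn0 : 0 < INR (S n)) by (apply lt_0_INR; lia).
  assert (E : Csum (fun j => circle_point rho N j ^ S n)%C N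
              = (rho ^ S n * Csum (fun j => w ^ j) N)%C).
  { rewrite <- Csum_scal. apply Csum_ext. intros j _. unfold circle_point, w.
    rewrite Cpow_mult_l, !cis_pow. f_equal. f_equal. field; lra. }
  rewrite E.
  assert (Hw : w <> RtoC 1).
  { apply cis_neq_1. generalize PI_RGT_0; intros HPI.
    assert (INR (S n) < INR (S N)) by (apply lt_INR; lia).
    split.
    - apply Rdiv_lt_0_compat; [apply Rmult_lt_0_compat; lra | lra].
    - apply Rmult_lt_reg_r with (INR (S N)); [lra |]. field_simplify; [nra | lra]. }
  assert (Hw1 : (w ^ S N = 1)%C).
  { unfold w. rewrite cis_pow.
    replace (INR (S N) * (2 * PI * INR (S n) / INR (S N))) with (0 + 2 * INR (S n) * PI)
      by (field; lra).
    unfold cis. rewrite cos_period, sin_period, cos_0, sin_0. reflexivity. }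
  assert (G : forall M, ((w - 1) * Csum (fun j => w ^ j) M = w ^ S M - 1)%C).
  { induction M as [|M IH]; [rewrite Csum_0; simpl; ring |].
    rewrite Csum_S, Cmult_plus_distr_l, IH, (Cpow_S w (S M)). ring. }
  assert (Z : Csum (fun j => w ^ j)%C N = RtoC 0).
  { specialize (G N). rewrite Hw1 in G.
    assert (Hw' : (w - 1)%C <> RtoC 0).
    { intros E0. apply Hw. replace w with (w - 1 + 1)%C by ring. rewrite E0. ring. }
    replace (Csum (fun j => w ^ j)%C N) with (((w - 1) * Csum (fun j => w ^ j) N) / (w - 1))%C
      by (field; exact Hw').
    rewrite G. field. exact Hw'. }
  rewrite Z. ring.
Qed.

Lemma conj_mul_circle rho z n : Cmod z = rho -> (z ^ n * Cconj z ^ n = RtoC (rho ^ (2 * n)))%C.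
Proof.
  intros Hz. rewrite <- Cpow_mult_l, <- Cmod2_conj, Hz, RtoC_pow.
  rewrite <- !RtoC_pow, pow_mult. reflexivity.
Qed.

(** On the circle [z * Cconj z] is the constant [rho ^ 2], so the monomial is a
    constant times a pure power of [z] or of its conjugate. *)
Lemma has_mean_monomial rho i j : 0 <= rho ->
  has_mean rho (fun z => z ^ i * Cconj (z ^ j))%C
    (if Nat.eq_dec i j then RtoC (rho ^ (2 * j)) else RtoC 0).
Proof.
  intros Hr. destruct (Nat.eq_dec i j) as [-> | Hij].
  - apply (has_mean_ext rho (fun _ => RtoC (rho ^ (2 * j)))); [exact Hr | | apply has_mean_const].
    intros z Hz. rewrite Cpow_conj. symmetry; apply conj_mul_circle, Hz.
  - destruct (le_lt_dec i j) as [H | H].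
    + destruct (Nat.le_exists_sub i j H) as [p [Hp _]].
      destruct p as [|p]; [lia |]. subst j.
      generalize (has_mean_scal rho (RtoC (rho ^ (2 * i))) _ _ (has_mean_conj _ _ _ (has_mean_pow rho p Hr))).
      replace (RtoC (rho ^ (2 * i)) * Cconj 0)%C with (RtoC 0)
        by (apply injective_projections; simpl; ring).
      apply has_mean_ext; [exact Hr |]. intros z Hz.
      rewrite !Cpow_conj, Cpow_add_r, <- (conj_mul_circle rho z i Hz). ring.
    + destruct (Nat.le_exists_sub j i ltac:(lia)) as [p [Hp _]].
      destruct p as [|p]; [lia |]. subst i.
      generalize (has_mean_scal rho (RtoC (rho ^ (2 * j))) _ _ (has_mean_pow rho p Hr)).
      replace (RtoC (rho ^ (2 * j)) * 0)%C with (RtoC 0) by ring.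
      apply has_mean_ext; [exact Hr |]. intros z Hz.
      rewrite !Cpow_conj, Cpow_add_r, <- (conj_mul_circle rho z j Hz). ring.
Qed.

(** * Means of power series *)

Definition abs_summable (rho : R) (c : nat -> C) : Prop :=
  ex_series (fun n => Cmod (c n) * rho ^ n).

Definition power_sum_on (rho : R) (c : nat -> C) (F : C -> C) : Prop :=
  forall z, Cmod z = rho -> Cseries (fun n => c n * z ^ n)%C (F z).

Lemma power_sum_bound rho c F z :
  abs_summable rho c -> power_sum_on rho c F -> Cmod z = rho ->
  Cmod (F z) <= Series (fun n => Cmod (c n) * rho ^ n).
Proof.
  intros Hc HF Hz. apply (Cseries_Cmod_le (fun n => c n * z ^ n)%C); [| exact Hc | auto].
  intros k. rewrite Cmod_mult, Cmod_pow, Hz. lra.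
Qed.

Lemma has_mean_mul_conj_pow rho c F j :
  0 <= rho -> abs_summable rho c -> power_sum_on rho c F ->
  has_mean rho (fun z => F z * Cconj (z ^ j))%C (c j * RtoC (rho ^ (2 * j)))%C.
Proof.
  intros Hr Hc HF.
  apply (has_mean_series rho (fun n z => c n * (z ^ n * Cconj (z ^ j)))%C _
           (fun n => rho ^ j * (Cmod (c n) * rho ^ n))
           (fun n => c n * (if Nat.eq_dec n j then RtoC (rho ^ (2 * j)) else RtoC 0))%C).
  - exact Hr.
  - intros m z Hz. rewrite !Cmod_mult, Cmod_conj, !Cmod_pow, Hz. lra.
  - exact (ex_series_scal_l (rho ^ j) _ Hc).
  - intros z Hz. rewrite Cmult_comm.
    generalize (Cseries_scal (Cconj (z ^ j)) _ _ (HF z Hz)). apply Cseries_ext; intros n; ring.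
  - intros m. apply has_mean_scal, has_mean_monomial, Hr.
  - generalize (Cseries_single j (c j * RtoC (rho ^ (2 * j)))%C). apply Cseries_ext.
    intros n. destruct (Nat.eq_dec n j) as [-> |]; [reflexivity | ring].
Qed.

Lemma has_mean_mul_pow rho c F j :
  0 <= rho -> abs_summable rho c -> power_sum_on rho c F ->
  has_mean rho (fun z => F z * z ^ j)%C (if Nat.eq_dec j 0 then c 0%nat else RtoC 0).
Proof.
  intros Hr Hc HF.
  apply (has_mean_series rho (fun n z => c n * (z ^ (n + j)))%C _
           (fun n => rho ^ j * (Cmod (c n) * rho ^ n))
           (fun n => c n * (if Nat.eq_dec (n + j) 0 then RtoC 1 else RtoC 0))%C).
  - exact Hr.
  - intros m z Hz. rewrite !Cmod_mult, !Cmod_pow, Hz, pow_add. lra.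
  - exact (ex_series_scal_l (rho ^ j) _ Hc).
  - intros z Hz. rewrite Cmult_comm.
    generalize (Cseries_scal (z ^ j) _ _ (HF z Hz)). apply Cseries_ext; intros n.
    rewrite Cpow_add_r; ring.
  - intros m. apply has_mean_scal. destruct (m + j)%nat as [|p].
    + exact (has_mean_const rho 1).
    + exact (has_mean_pow rho p Hr).
  - generalize (Cseries_single 0 (if Nat.eq_dec j 0 then c 0%nat else RtoC 0)). apply Cseries_ext.
    intros n. destruct (Nat.eq_dec n 0) as [-> |].
    + simpl. destruct (Nat.eq_dec j 0); ring.
    + destruct (Nat.eq_dec (n + j) 0); [lia | ring].
Qed.

(** A product of two analytic functions averages to its value at the centre. Averaging
    the second series term by term avoids Cauchy products. *)
Lemma has_mean_mul rho c d F G :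
  0 <= rho -> abs_summable rho c -> power_sum_on rho c F ->
  abs_summable rho d -> power_sum_on rho d G ->
  has_mean rho (fun z => F z * G z)%C (c 0%nat * d 0%nat)%C.
Proof.
  intros Hr Hc HF Hd HG.
  set (K := Series (fun n => Cmod (c n) * rho ^ n)).
  apply (has_mean_series rho (fun n z => d n * (F z * z ^ n))%C _
           (fun n => K * (Cmod (d n) * rho ^ n))
           (fun n => d n * (if Nat.eq_dec n 0 then c 0%nat else RtoC 0))%C).
  - exact Hr.
  - intros m z Hz. rewrite !Cmod_mult, Cmod_pow, Hz.
    assert (H := power_sum_bound _ _ _ _ Hc HF Hz). fold K in H.
    assert (0 <= Cmod (d m) * rho ^ m) by (apply Rmult_le_pos; [apply Cmod_ge_0 | apply pow_le, Hr]).
    nra.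
  - exact (ex_series_scal_l K _ Hd).
  - intros z Hz. generalize (Cseries_scal (F z) _ _ (HG z Hz)). apply Cseries_ext; intros n; ring.
  - intros m. apply has_mean_scal, has_mean_mul_pow with (c := c); assumption.
  - generalize (Cseries_single 0 (c 0%nat * d 0%nat)%C). apply Cseries_ext.
    intros n. destruct (Nat.eq_dec n 0) as [-> |]; ring.
Qed.

(** Polarised Parseval identity. It also yields the reproducing property of the
    Szego kernel: with [d n = (Cconj zeta / rho ^ 2) ^ n] the limit is the value of [F] at [zeta]. *)
Lemma has_mean_mul_conj rho c d F G L :
  0 <= rho -> abs_summable rho c -> power_sum_on rho c F ->
  abs_summable rho d -> power_sum_on rho d G ->
  Cseries (fun n => c n * Cconj (d n) * RtoC (rho ^ (2 * n)))%C L ->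
  has_mean rho (fun z => F z * Cconj (G z))%C L.
Proof.
  intros Hr Hc HF Hd HG HL.
  set (K := Series (fun n => Cmod (c n) * rho ^ n)).
  apply (has_mean_series rho (fun n z => Cconj (d n) * (F z * Cconj (z ^ n)))%C _
           (fun n => K * (Cmod (d n) * rho ^ n))
           (fun n => Cconj (d n) * (c n * RtoC (rho ^ (2 * n))))%C).
  - exact Hr.
  - intros m z Hz. rewrite !Cmod_mult, !Cmod_conj, Cmod_pow, Hz.
    assert (H := power_sum_bound _ _ _ _ Hc HF Hz). fold K in H.
    assert (0 <= Cmod (d m) * rho ^ m) by (apply Rmult_le_pos; [apply Cmod_ge_0 | apply pow_le, Hr]).
    nra.
  - exact (ex_series_scal_l K _ Hd).
  - intros z Hz. generalize (Cseries_scal (F z) _ _ (Cseries_conj _ _ (HG z Hz))).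
    apply Cseries_ext; intros n. rewrite Cmult_conj; ring.
  - intros m. apply has_mean_scal, has_mean_mul_conj_pow with (c := c); assumption.
  - revert HL. apply Cseries_ext. intros n. ring.
Qed.

(** * Parseval's identity *)

Lemma Cconj_RtoC (x : R) : Cconj (RtoC x) = RtoC x.
Proof. apply injective_projections; simpl; ring. Qed.

Lemma Cseries_RtoC (u : nat -> R) (l : R) :
  is_series u l -> Cseries (fun n => RtoC (u n)) (RtoC l).
Proof.
  intros H. apply Cseries_Ccvg. intros eps He.
  assert (H' : is_lim_seq (sum_n u) l) by exact H.
  apply is_lim_seq_spec in H'. destruct (H' (mkposreal eps He)) as [N HN].
  exists N. intros n Hn. specialize (HN n Hn). simpl in HN.
  replace (Csum (fun n => RtoC (u n)) n) with (RtoC (sum_n u n)).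
  - rewrite <- RtoC_minus, Cmod_R. exact HN.
  - clear. induction n as [|n IH].
    + rewrite Csum_0, sum_O. reflexivity.
    + rewrite Csum_S, sum_Sn, <- IH. unfold plus; simpl. apply RtoC_plus.
Qed.

Lemma abs_summable_sqr rho c :
  0 <= rho -> abs_summable rho c -> ex_series (fun n => Cmod (c n) ^ 2 * rho ^ (2 * n)).
Proof.
  intros Hr Hc.
  assert (Hp : forall n, 0 <= Cmod (c n) * rho ^ n)
    by (intros; apply Rmult_le_pos; [apply Cmod_ge_0 | apply pow_le, Hr]).
  destruct (filterlim_bounded (fun n => Cmod (c n) * rho ^ n)) as [M HM].
  { exists 0. apply (ex_series_lim_0 _ Hc). }
  apply (@ex_series_le R_AbsRing R_CompleteNormedModule _ (fun n => M * (Cmod (c n) * rho ^ n))).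
  - intros n. specialize (HM n). specialize (Hp n).
    change (Rabs (Cmod (c n) * rho ^ n) <= M) in HM.
    change (Rabs (Cmod (c n) ^ 2 * rho ^ (2 * n)) <= M * (Cmod (c n) * rho ^ n)).
    replace (Cmod (c n) ^ 2 * rho ^ (2 * n)) with ((Cmod (c n) * rho ^ n) ^ 2)
      by (rewrite Nat.mul_comm, pow_mult; ring).
    rewrite Rabs_pos_eq in HM |- * by nra. nra.
  - exact (ex_series_scal_l M _ Hc).
Qed.

Lemma parseval rho c F :
  0 <= rho -> abs_summable rho c -> power_sum_on rho c F ->
  has_mean rho (fun z => RtoC (Cmod (F z) ^ 2))
    (RtoC (Series (fun n => Cmod (c n) ^ 2 * rho ^ (2 * n)))).
Proof.
  intros Hr Hc HF.
  apply (has_mean_ext rho (fun z => F z * Cconj (F z))%C); [exact Hr | |].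
  - intros z _. symmetry; apply Cmod2_conj.
  - apply has_mean_mul_conj with c c; try assumption.
    generalize (Cseries_RtoC _ _ (Series_correct _ (abs_summable_sqr rho c Hr Hc))).
    apply Cseries_ext. intros n. rewrite RtoC_mult, Cmod2_conj. reflexivity.
Qed.

(** Littlewood's principle in the form used throughout: a pointwise bound on one circle
    becomes a bound between weighted square sums of coefficients. *)
Lemma parseval_le rho c d F G K :
  0 <= rho -> abs_summable rho c -> power_sum_on rho c F ->
  abs_summable rho d -> power_sum_on rho d G ->
  (forall z, Cmod z = rho -> Cmod (F z) ^ 2 <= K * Cmod (G z) ^ 2) ->
  Series (fun n => Cmod (c n) ^ 2 * rho ^ (2 * n))
  <= K * Series (fun n => Cmod (d n) ^ 2 * rho ^ (2 * n)).
Proof.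
  intros Hr Hc HF Hd HG H.
  assert (HM := has_mean_plus _ _ _ _ _
           (has_mean_scal rho (RtoC K) _ _ (parseval rho d G Hr Hd HG))
           (has_mean_scal rho (RtoC (-1)) _ _ (parseval rho c F Hr Hc HF))).
  apply has_mean_Re_ge_0 in HM; [| exact Hr |].
  - rewrite <- !RtoC_mult, <- RtoC_plus in HM. unfold Re, RtoC in HM; cbn [fst] in HM. lra.
  - intros z Hz. specialize (H z Hz).
    rewrite <- !RtoC_mult, <- RtoC_plus. unfold Re, RtoC; cbn [fst]. lra.
Qed.

(** * The Schwarz-Pick inequality *)

Lemma one_minus_neq_0 (s : C) : Cmod s < 1 -> (1 - s)%C <> RtoC 0.
Proof.
  intros H E. replace s with (1 - (1 - s))%C in H by ring.
  rewrite E in H. replace (1 - 0)%C with (RtoC 1) in H by ring. rewrite Cmod_1 in H. lra.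
Qed.

(** The reproducing kernel at [zeta] of the Hardy space of the disk of radius [rho]. *)
Definition szego (rho : R) (zeta z : C) : C := (/ (1 - Cconj zeta / RtoC (rho ^ 2) * z))%C.

(** A quadratic form in [lam], [mu] that stays nonnegative has nonpositive discriminant;
    the second choice below treats the degenerate case [A = 0]. *)
Lemma discriminant_bound x y A B :
  0 < x -> 0 <= y ->
  (forall lam mu, 0 <= lam ^ 2 * A - 2 * (lam * mu * x) + mu ^ 2 * (x * (y * B))) ->
  x <= y * (A * B).
Proof.
  intros Hx Hy H.
  assert (HA : 0 <= A) by (specialize (H 1 0); lra).
  destruct HA as [HA | HA].
  - specialize (H x A).
    assert (H' : 0 <= (x * A) * (y * (A * B) - x)) by lra.
    assert (0 < x * A) by (apply Rmult_lt_0_compat; assumption). nra.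
  (* Any lam above y B / 2 contradicts the form being nonnegative at mu = 1. *)
  - specialize (H (y * B / 2 + 1) 1). subst A. lra.
Qed.

(** Both [2 |f| |e| <= |f| ^ 2 + |e| ^ 2] and [|w| <= 1] are used pointwise on the circle; averaged,
    this says that multiplication by a bounded function is a contraction for the mean square norm. *)
Lemma amgm_form (w f e : C) : Cmod w <= 1 ->
  0 <= Re (f * Cconj f + e * Cconj e - 2 * (w * (f * Cconj e)))%C.
Proof.
  intros Hw. rewrite <- !Cmod2_conj.
  assert (H := re_le_Cmod (w * (f * Cconj e))). rewrite !Cmod_mult, Cmod_conj in H.
  assert (Hf := Cmod_ge_0 f). assert (He := Cmod_ge_0 e). assert (Hw0 := Cmod_ge_0 w).
  set (W := (w * (f * Cconj e))%C) in *.
  replace (Re (RtoC (Cmod f ^ 2) + RtoC (Cmod e ^ 2) - 2 * W)%C)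
    with (Cmod f ^ 2 + Cmod e ^ 2 - 2 * Re W)
    by (destruct W as [W1 W2]; unfold Re, Cminus, Cplus, Copp, Cmult, RtoC; simpl fst; ring).
  assert (Hm : 0 <= Cmod f * Cmod e) by nra.
  assert (Cmod w * (Cmod f * Cmod e) <= Cmod f * Cmod e) by nra.
  assert (HW : Re W <= Cmod f * Cmod e) by (generalize (Rle_abs (Re W)); lra).
  assert (Hs := pow2_ge_0 (Cmod f - Cmod e)). lra.
Qed.

Section Kernel.
Variables (rho : R) (zeta : C).
Hypothesis Hrho : 0 < rho.
Hypothesis Hzeta : Cmod zeta < rho.

Let t := (Cmod zeta / rho) ^ 2.
Let tau := t / (1 - t).

Lemma RtoC_rho2 : RtoC (rho ^ 2) <> RtoC 0.
Proof. intros E. apply RtoC_inj in E. nra. Qed.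

Lemma Cmod_ratio : Cmod (Cconj zeta / RtoC (rho ^ 2)) = Cmod zeta / rho ^ 2.
Proof.
  rewrite Cmod_div by exact RtoC_rho2. rewrite Cmod_conj, Cmod_R, Rabs_pos_eq by nra. reflexivity.
Qed.

Lemma ratio_lt_1 : 0 <= Cmod zeta / rho < 1.
Proof.
  assert (H := Cmod_ge_0 zeta). split.
  - apply Rdiv_le_0_compat; assumption.
  - apply Rmult_lt_reg_r with rho; [exact Hrho |]. field_simplify; lra.
Qed.

Lemma Cmod_ratio_mul z : Cmod z = rho -> Cmod (Cconj zeta / RtoC (rho ^ 2) * z) = Cmod zeta / rho.
Proof. intros Hz. rewrite Cmod_mult, Cmod_ratio, Hz. field. lra. Qed.

Lemma szego_power_sum :
  power_sum_on rho (fun n => (Cconj zeta / RtoC (rho ^ 2)) ^ n)%C (szego rho zeta).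
Proof.
  intros z Hz. unfold szego.
  apply (Cseries_ext (fun n => (Cconj zeta / RtoC (rho ^ 2) * z) ^ n)%C).
  - intros n. apply Cpow_mult_l.
  - apply Cseries_geom. rewrite (Cmod_ratio_mul z Hz). apply ratio_lt_1.
Qed.

Lemma szego_abs_summable :
  abs_summable rho (fun n => (Cconj zeta / RtoC (rho ^ 2)) ^ n)%C.
Proof.
  unfold abs_summable. apply (ex_series_ext (fun n => (Cmod zeta / rho) ^ n)).
  - intros n. rewrite Cmod_pow, Cmod_ratio, <- Rpow_mult_distr. f_equal. field. lra.
  - apply ex_series_geom. assert (H := ratio_lt_1). rewrite Rabs_pos_eq; lra.
Qed.

(** With [s = Cconj zeta * z / rho ^ 2] one has [|s| ^ 2 = t] on the circle, and the claim is the
    identity between the Poisson and the Szego kernels, [(1 - t) / |1 - s| ^ 2] being the sum of [1 / (1 - s)]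
    and its conjugate minus 1. It turns every product of two kernels into a linear combination, so
    that means against them are known. *)
Lemma szego_sqr z : Cmod z = rho ->
  ((szego rho zeta z - 1) * Cconj (szego rho zeta z - 1)
   = RtoC tau * (szego rho zeta z + Cconj (szego rho zeta z) - 1))%C.
Proof.
  intros Hz. assert (Hs := Cmod_ratio_mul z Hz). assert (Hl := ratio_lt_1).
  unfold szego. set (s := (Cconj zeta / RtoC (rho ^ 2) * z)%C) in *.
  assert (H1 : (1 - s)%C <> RtoC 0) by (apply one_minus_neq_0; lra).
  assert (H2 : (1 - Cconj s)%C <> RtoC 0) by (apply one_minus_neq_0; rewrite Cmod_conj; lra).
  assert (Ht : t < 1) by (unfold t; nra).
  assert (Et : RtoC t = (s * Cconj s)%C) by (unfold t; rewrite <- Hs; apply Cmod2_conj).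
  assert (H3 : (1 - s * Cconj s)%C <> RtoC 0).
  { rewrite <- Et, <- RtoC_minus. intros E; apply RtoC_inj in E; lra. }
  rewrite Cminus_conj, Cinv_conj, Cminus_conj by exact H1.
  rewrite Cconj_RtoC.
  unfold tau. rewrite RtoC_div, RtoC_minus, Et by lra. field. auto.
Qed.

(** The sesquilinear form of multiplication by [F] on the span of the constants and of
    [szego rho zeta - 1], which are orthogonal of squared norms 1 and [tau]. Its matrix is triangular, with
    diagonal [F 0], [F zeta]; Schwarz-Pick says that this matrix is a contraction. *)
Lemma has_mean_kernel_form (c : nat -> C) (F : C -> C) (eta u v p q : C) :
  abs_summable rho c -> power_sum_on rho c F -> Cseries (fun n => c n * zeta ^ n)%C eta ->
  has_mean rho
    (fun z => F z * ((u + v * (szego rho zeta z - 1))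
                     * Cconj (p + q * (szego rho zeta z - 1))))%C
    (u * Cconj p * c 0%nat + u * Cconj q * (eta - c 0%nat)
     + v * Cconj q * eta * RtoC tau)%C.
Proof.
  intros Hc HF He. assert (Hr : 0 <= rho) by lra.
  assert (M0 := has_mean_mul_pow rho c F 0 Hr Hc HF). simpl in M0.
  assert (M1 := has_mean_mul rho c _ F _ Hr Hc HF szego_abs_summable szego_power_sum).
  assert (M2 : has_mean rho (fun z => F z * Cconj (szego rho zeta z))%C eta).
  { apply (has_mean_mul_conj rho c _ F _ eta Hr Hc HF szego_abs_summable szego_power_sum).
    revert He. apply Cseries_ext. intros n.
    rewrite Cpow_conj, Cdiv_conj, Cconj_conj by exact RtoC_rho2.
    rewrite Cconj_RtoC.
    replace (RtoC (rho ^ (2 * n))) with (RtoC (rho ^ 2) ^ n)%C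
      by (rewrite <- RtoC_pow, <- pow_mult; reflexivity).
    rewrite <- Cmult_assoc, <- Cpow_mult_l. f_equal. f_equal.
    field. exact RtoC_rho2. }
  set (al := (u * Cconj p + v * Cconj q * RtoC tau)%C).
  set (be := (v * Cconj p + v * Cconj q * RtoC tau)%C).
  set (ga := (u * Cconj q + v * Cconj q * RtoC tau)%C).
  assert (M := has_mean_plus _ _ _ _ _ (has_mean_scal rho (al - be - ga) _ _ M0)
     (has_mean_plus _ _ _ _ _ (has_mean_scal rho be _ _ M1) (has_mean_scal rho ga _ _ M2))).
  simpl in M.
  match type of M with has_mean _ _ ?L =>
    replace (u * Cconj p * c 0%nat + u * Cconj q * (eta - c 0%nat)
     + v * Cconj q * eta * RtoC tau)%C with L by (unfold al, be, ga; ring) end.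
  revert M. apply has_mean_ext; [exact Hr |]. intros z Hz. simpl.
  assert (Hsq := szego_sqr z Hz). revert Hsq.
  generalize (szego rho zeta z). intros k Hk.
  rewrite Cplus_conj, Cmult_conj.
  transitivity (F z * (u * Cconj p + u * Cconj q * Cconj (k - 1)
    + v * Cconj p * (k - 1) + v * Cconj q * ((k - 1) * Cconj (k - 1))))%C; [| ring].
  rewrite Hk, Cminus_conj.
  rewrite Cconj_RtoC.
  unfold al, be, ga. ring.
Qed.

(** Averaging [amgm_form] with [f = u + v (k - 1)] and [e = p + q (k - 1)], where [k] is the Szego
    kernel, gives a numerical inequality between [c 0] and [eta]. The best [p] and [v] for given [u] and [q] are
    [u * c 0] and [Cconj eta * q]; what remains is a form in two real parameters [lam] and [mu]. Thus the
    Schwarz lemma is reached without the maximum principle. *)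
Lemma schwarz_pick_circle (c : nat -> C) (h : C -> C) (eta : C) :
  abs_summable rho c -> power_sum_on rho c h ->
  (forall z, Cmod z = rho -> Cmod (h z) <= 1) ->
  Cseries (fun n => c n * zeta ^ n)%C eta ->
  Cmod (eta - c 0%nat) ^ 2 <= tau * ((1 - Cmod (c 0%nat) ^ 2) * (1 - Cmod eta ^ 2)).
Proof.
  intros Hc Hh Hb He.
  assert (Htau : 0 <= tau).
  { assert (Hl := ratio_lt_1). unfold tau, t. apply Rdiv_le_0_compat; nra. }
  set (X := (eta - c 0%nat)%C).
  destruct (Cmod_ge_0 X) as [HX | HX].
  2: { assert (E : eta = c 0%nat).
       { symmetry in HX. apply Cmod_eq_0 in HX.
         transitivity (X + c 0%nat)%C; [unfold X; ring | rewrite HX; ring]. }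
       rewrite <- HX, E.
       assert (0 <= tau * (1 - Cmod (c 0%nat) ^ 2) ^ 2) by (apply Rmult_le_pos; [lra | apply pow2_ge_0]).
       lra. }
  apply discriminant_bound; [nra | exact Htau |]. intros lam mu.
  (* The norms of f and e are the same form for the constant function 1. *)
  set (one := fun n : nat => if Nat.eq_dec n 0 then RtoC 1 else RtoC 0).
  assert (O1 : abs_summable rho one).
  { apply (proj2 (ex_series_incr_1 (fun n => Cmod (one n) * rho ^ n))).
    apply (ex_series_ext (fun n => 0 * 0 ^ n)).
    - intros n. unfold one. simpl. rewrite Cmod_0. ring.
    - apply (ex_series_scal_l 0 (fun n => 0 ^ n)), ex_series_geom. rewrite Rabs_R0; lra. }
  assert (O3 : forall z, Cseries (fun n => one n * z ^ n)%C 1).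
  { intros z. generalize (Cseries_single 0 1). apply Cseries_ext. intros n. unfold one.
    destruct (Nat.eq_dec n 0) as [-> |]; simpl; ring. }
  assert (O2 : power_sum_on rho one (fun _ => RtoC 1)) by (intros z _; apply O3).
  set (u := RtoC lam). set (p := (RtoC lam * c 0%nat)%C).
  set (v := (Cconj eta * (RtoC mu * X))%C). set (q := (RtoC mu * X)%C).
  assert (M1 := has_mean_kernel_form one _ _ u v u v O1 O2 (O3 zeta)).
  assert (M2 := has_mean_kernel_form one _ _ p q p q O1 O2 (O3 zeta)).
  assert (M3 := has_mean_kernel_form c _ _ u v p q Hc Hh He).
  assert (M := has_mean_plus _ _ _ _ _ (has_mean_plus _ _ _ _ _ M1 M2)
                 (has_mean_scal _ (-2) _ _ M3)).
  apply has_mean_Re_ge_0 in M; [| lra |].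
  - replace (lam ^ 2 * (1 - Cmod (c 0%nat) ^ 2) - 2 * (lam * mu * Cmod X ^ 2)
              + mu ^ 2 * (Cmod X ^ 2 * (tau * (1 - Cmod eta ^ 2))))
      with (Re (RtoC (lam ^ 2 * (1 - Cmod (c 0%nat) ^ 2) - 2 * (lam * mu * Cmod X ^ 2)
              + mu ^ 2 * (Cmod X ^ 2 * (tau * (1 - Cmod eta ^ 2)))))) by reflexivity.
    refine (eq_ind _ (fun x => 0 <= Re x) M _ _).
    repeat (rewrite RtoC_plus || rewrite RtoC_minus || rewrite RtoC_mult).
    rewrite !Cmod2_conj, !RtoC_pow.
    unfold u, v, p, q. fold X. change (one 0%nat) with (RtoC 1).
    repeat (rewrite Cmult_conj || rewrite Cconj_conj).
    rewrite !Cconj_RtoC. ring.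
  - intros z Hz. cbv beta.
    assert (HA := amgm_form (h z) (u + v * (szego rho zeta z - 1))%C
                    (p + q * (szego rho zeta z - 1))%C (Hb z Hz)).
    match type of HA with 0 <= Re ?x =>
      match goal with |- 0 <= Re ?y => replace y with x by ring end end.
    exact HA.
Qed.

End Kernel.

Definition disk_series (a : nat -> C) (h : C -> C) : Prop :=
  forall z, Cmod z < 1 -> Cseries (fun n => a n * z ^ n)%C (h z).

(** Convergence at a point [s] further out bounds the terms there, hence the radius of
    convergence of the moduli; this gives access to the theory of real power series. *)
Lemma disk_series_radius a h rho :
  disk_series a h -> 0 <= rho < 1 -> Rbar_lt (Rabs rho) (CV_radius (fun n => Cmod (a n))).
Proof.
  intros Hh Hr. rewrite Rabs_pos_eq by lra.
  set (s := (1 + rho) / 2).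
  apply Rbar_lt_le_trans with s; [simpl; unfold s; lra |].
  apply (proj1 (CV_radius_bounded (fun n => Cmod (a n)))).
  assert (Hs : Cmod (RtoC s) < 1) by (rewrite Cmod_R, Rabs_pos_eq; unfold s; lra).
  assert (H := Hh _ Hs).
  destruct (@filterlim_bounded C_AbsRing C_NormedModule (Csum (fun n => (a n * RtoC s ^ n)%C))) as [M HM].
  { exists (h (RtoC s)). exact H. }
  exists (2 * M). intros n.
  change (forall n, Cmod (Csum (fun n => (a n * RtoC s ^ n)%C) n) <= M) in HM.
  rewrite Rabs_pos_eq by (apply Rmult_le_pos; [apply Cmod_ge_0 | apply pow_le; unfold s; lra]).
  replace (Cmod (a n) * s ^ n) with (Cmod (a n * RtoC s ^ n))
    by (rewrite Cmod_mult, Cmod_pow, Cmod_R, Rabs_pos_eq by (unfold s; lra); reflexivity).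
  assert (HM0 : 0 <= M) by (eapply Rle_trans; [apply Cmod_ge_0 | apply (HM 0%nat)]).
  destruct n as [|n].
  - specialize (HM 0%nat). rewrite Csum_0 in HM. lra.
  - assert (H1 := HM n). assert (H2 := HM (S n)). rewrite Csum_S in H2.
    assert (Ht := Cmod_triangle (Csum (fun n => (a n * RtoC s ^ n)%C) n + a (S n) * RtoC s ^ S n)
                    (- Csum (fun n => (a n * RtoC s ^ n)%C) n)).
    rewrite Cmod_opp in Ht.
    match type of Ht with Cmod ?x <= _ =>
      replace x with (a (S n) * RtoC s ^ S n)%C in Ht by ring end.
    lra.
Qed.

Lemma disk_series_abs a h rho :
  disk_series a h -> 0 <= rho < 1 -> abs_summable rho a.
Proof.
  intros Hh Hr. assert (H := CV_disk_inside _ _ (disk_series_radius a h rho Hh Hr)).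
  revert H. apply ex_series_ext. intros n.
  apply Rabs_pos_eq, Rmult_le_pos; [apply Cmod_ge_0 | apply pow_le, Hr].
Qed.

Lemma disk_series_on a h rho : disk_series a h -> rho < 1 -> power_sum_on rho a h.
Proof. intros H Hr z Hz. apply H. lra. Qed.

(** The inequality on circles of radius [rho] tends to this one as [rho] tends to 1. In the usual
    form it reads [|h z - a 0| <= |z| |1 - Cconj (a 0) * h z|], by [Cmod_blaschke]. *)
Lemma schwarz_pick a h z :
  disk_series a h -> (forall w, Cmod w < 1 -> Cmod (h w) <= 1) -> Cmod z < 1 ->
  (1 - Cmod z ^ 2) * Cmod (h z - a 0%nat) ^ 2
  <= Cmod z ^ 2 * ((1 - Cmod (a 0%nat) ^ 2) * (1 - Cmod (h z) ^ 2)).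
Proof.
  intros Hh Hb Hz. assert (Hz0 := Cmod_ge_0 z).
  set (r := Cmod z) in *. set (x := Cmod (h z - a 0%nat) ^ 2).
  set (Y := (1 - Cmod (a 0%nat) ^ 2) * (1 - Cmod (h z) ^ 2)).
  assert (Hx : 0 <= x) by apply pow2_ge_0.
  assert (H : forall rho, r < rho < 1 -> (rho ^ 2 - r ^ 2) * x <= r ^ 2 * Y).
  { intros rho Hr.
    assert (S := schwarz_pick_circle rho z ltac:(lra) ltac:(fold r; lra) a h (h z)
      (disk_series_abs a h rho Hh ltac:(lra)) (disk_series_on a h rho Hh ltac:(lra))
      (fun w Hw => Hb w ltac:(lra)) (Hh z Hz)).
    fold r x Y in S.
    assert (Hd : 0 < rho ^ 2 - r ^ 2) by nra.
    replace ((r / rho) ^ 2 / (1 - (r / rho) ^ 2)) with (r ^ 2 / (rho ^ 2 - r ^ 2)) in S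
      by (field; repeat split; nra).
    apply (Rmult_le_compat_l (rho ^ 2 - r ^ 2)) in S; [| lra].
    replace ((rho ^ 2 - r ^ 2) * (r ^ 2 / (rho ^ 2 - r ^ 2) * Y)) with (r ^ 2 * Y) in S
      by (field; lra).
    exact S. }
  apply Rnot_lt_le. intros Hlt.
  set (d := (1 - r ^ 2) * x - r ^ 2 * Y) in *.
  assert (Hd : 0 < d) by (unfold d; lra).
  (* With rho = 1 - e the left-hand side drops by at most 2 e x, too little to absorb the excess d. *)
  set (e := Rmin ((1 - r) / 2) (d / (4 * (x + 1)))).
  assert (He : 0 < e).
  { unfold e. apply Rmin_glb_lt; [lra |]. apply Rdiv_lt_0_compat; lra. }
  assert (He1 : e <= (1 - r) / 2) by apply Rmin_l.
  assert (He2 : e * (4 * (x + 1)) <= d).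
  { apply Rle_trans with (d / (4 * (x + 1)) * (4 * (x + 1))).
    - apply Rmult_le_compat_r; [lra | apply Rmin_r].
    - right. field. lra. }
  specialize (H (1 - e) ltac:(lra)).
  assert ((1 - 2 * e) * x <= (1 - e) ^ 2 * x) by nra.
  assert (0 <= e * x) by nra. unfold d in *. nra.
Qed.

(** * Coefficients and growth of bounded functions *)

Definition affine_coeffs (k v : C) (c : nat -> C) (n : nat) : C :=
  match n with O => v | S _ => (k * c n)%C end.

Lemma affine_abs_summable rho k v c :
  abs_summable rho c -> abs_summable rho (affine_coeffs k v c).
Proof.
  intros H. apply (proj2 (ex_series_incr_1 (fun n => Cmod (affine_coeffs k v c n) * rho ^ n))).
  apply (ex_series_ext (fun n => Cmod k * (Cmod (c (S n)) * rho ^ S n))).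
  - intros n. unfold affine_coeffs. rewrite Cmod_mult. symmetry; apply Rmult_assoc.
  - apply (ex_series_scal_l (Cmod k) (fun n => Cmod (c (S n)) * rho ^ S n)).
    apply (proj1 (ex_series_incr_1 (fun n => Cmod (c n) * rho ^ n)) H).
Qed.

Lemma affine_power_sum rho k v c F :
  power_sum_on rho c F ->
  power_sum_on rho (affine_coeffs k v c) (fun z => k * (F z - c 0%nat) + v)%C.
Proof.
  intros H z Hz.
  assert (H1 := is_series_plus _ _ _ _ (Cseries_scal k _ _ (H z Hz))
                  (Cseries_single 0 (v - k * c 0%nat)%C)).
  replace (k * (F z - c 0%nat) + v)%C with (k * F z + (v - k * c 0%nat))%C by ring.
  revert H1. apply Cseries_ext. intros n.
  match goal with |- plus ?x ?y = ?w => change ((x + y)%C = w) end.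
  destruct n; simpl; ring.
Qed.

Lemma Cmod_blaschke (a w : C) :
  Cmod (1 - Cconj a * w) ^ 2 =
  Cmod (w - a) ^ 2 + (1 - Cmod a ^ 2) * (1 - Cmod w ^ 2).
Proof.
  rewrite !Cmod2_alt. destruct a as [a1 a2], w as [w1 w2].
  unfold Re, Im, Cconj, Cminus, Cplus, Copp, Cmult, RtoC; cbn [fst snd]. ring.
Qed.

(** Put [H = h - a 0], whose square mean [S] on the circle is the sum on the left. Schwarz-Pick
    says [|H| <= r |Cconj (a 0) * H - (1 - |a 0| ^ 2)|] there. As [H] has mean 0, the square mean of the right-hand side
    is [r ^ 2 (|a 0| ^ 2 S + (1 - |a 0| ^ 2) ^ 2)], and the bound follows by solving for [S]. *)
Lemma coeff_sum_bound a h r :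
  disk_series a h -> (forall w, Cmod w < 1 -> Cmod (h w) <= 1) -> 0 <= r < 1 ->
  (1 - Cmod (a 0%nat) ^ 2 * r ^ 2) * Series (fun k => Cmod (a (S k)) ^ 2 * r ^ (2 * S k))
  <= r ^ 2 * (1 - Cmod (a 0%nat) ^ 2) ^ 2.
Proof.
  intros Hh Hb Hr. set (al := Cmod (a 0%nat)).
  assert (Ha := disk_series_abs a h r Hh Hr).
  assert (Hp := disk_series_on a h r Hh ltac:(lra)).
  set (v := RtoC (- (1 - al ^ 2))).
  assert (H := parseval_le r _ _ _ _ (r ^ 2) (proj1 Hr)
    (affine_abs_summable r 1 0 a Ha) (affine_power_sum r 1 0 a h Hp)
    (affine_abs_summable r (Cconj (a 0%nat)) v a Ha)
    (affine_power_sum r (Cconj (a 0%nat)) v a h Hp)).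
  rewrite (Series_incr_1 (fun n => Cmod (affine_coeffs 1 0 a n) ^ 2 * r ^ (2 * n))),
    (Series_incr_1 (fun n => Cmod (affine_coeffs (Cconj (a 0%nat)) v a n) ^ 2 * r ^ (2 * n))) in H
    by (apply abs_summable_sqr; [lra | apply affine_abs_summable, Ha]).
  set (S0 := Series (fun k => Cmod (a (S k)) ^ 2 * r ^ (2 * S k))).
  replace (Series (fun k => Cmod (affine_coeffs 1 0 a (S k)) ^ 2 * r ^ (2 * S k))) with S0 in H
    by (apply Series_ext; intros k; unfold affine_coeffs; rewrite Cmult_1_l; reflexivity).
  replace (Series (fun k => Cmod (affine_coeffs (Cconj (a 0%nat)) v a (S k)) ^ 2 * r ^ (2 * S k)))
    with (al ^ 2 * S0) in H.
  2:{ unfold S0. rewrite <- Series_scal_l. apply Series_ext; intros k.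
      unfold affine_coeffs; rewrite Cmod_mult, Cmod_conj. fold al. ring. }
  replace (Cmod (affine_coeffs 1 0 a 0) ^ 2 * r ^ (2 * 0)) with 0 in H
    by (unfold affine_coeffs; rewrite Cmod_0; simpl; ring).
  replace (Cmod (affine_coeffs (Cconj (a 0%nat)) v a 0) ^ 2 * r ^ (2 * 0))
    with ((1 - al ^ 2) ^ 2) in H
    by (unfold affine_coeffs, v; rewrite Cmod_R, pow2_abs; simpl; ring).
  assert (H0 : 0 + S0 <= r ^ 2 * ((1 - al ^ 2) ^ 2 + al ^ 2 * S0)); [| lra].
  apply H. intros z Hz.
  assert (SP := schwarz_pick a h z Hh Hb ltac:(lra)). rewrite Hz in SP.
  replace (1 * (h z - a 0%nat) + 0)%C with (h z - a 0%nat)%C by ring.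
  replace (Cconj (a 0%nat) * (h z - a 0%nat) + v)%C with (- (1 - Cconj (a 0%nat) * h z))%C.
  - rewrite Cmod_opp, Cmod_blaschke. lra.
  - unfold v, al. rewrite RtoC_opp, RtoC_minus, Cmod2_conj. ring.
Qed.

(** The pseudo-hyperbolic distance of [|h z|] and [|a 0|] is at most that of [h z] and [a 0]. *)
Lemma growth_bound a h z :
  disk_series a h -> (forall w, Cmod w < 1 -> Cmod (h w) <= 1) -> Cmod z < 1 ->
  Cmod (a 0%nat) <= 1 ->
  Cmod (h z) * (1 + Cmod (a 0%nat) * Cmod z) <= Cmod (a 0%nat) + Cmod z.
Proof.
  intros Hh Hb Hz Ha. assert (SP := schwarz_pick a h z Hh Hb Hz).
  assert (Hy := Hb z Hz). assert (Hz0 := Cmod_ge_0 z). assert (Ha0 := Cmod_ge_0 (a 0%nat)).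
  assert (Hy0 := Cmod_ge_0 (h z)).
  assert (Ht : Cmod (h z) - Cmod (a 0%nat) <= Cmod (h z - a 0%nat)).
  { assert (T := Cmod_triangle (h z - a 0%nat) (a 0%nat)).
    replace (h z - a 0%nat + a 0%nat)%C with (h z) in T by ring. lra. }
  set (y := Cmod (h z)) in *. set (al := Cmod (a 0%nat)) in *. set (r := Cmod z) in *.
  set (x := Cmod (h z - a 0%nat)) in *.
  destruct (Rle_or_lt y al) as [Hya | Hya].
  { assert (0 <= r * (1 - al * y)) by (apply Rmult_le_pos; nra). nra. }
  assert (Hx : (y - al) ^ 2 <= x ^ 2) by nra.
  assert (H1 : (1 - r ^ 2) * (y - al) ^ 2 <= (1 - r ^ 2) * x ^ 2)
    by (apply Rmult_le_compat_l; [nra | exact Hx]).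
  assert (H2 : (y - al) ^ 2 <= (r * (1 - al * y)) ^ 2) by nra.
  assert (0 <= r * (1 - al * y)) by (apply Rmult_le_pos; nra).
  assert (y - al <= r * (1 - al * y)) by (apply Rnot_lt_le; intros L; nra).
  lra.
Qed.

(** * Termwise differentiation *)

Definition derive_coeffs (a : nat -> C) (n : nat) : C := (RtoC (INR (S n)) * a (S n))%C.

Lemma Cmod_derive_coeffs a n :
  Cmod (derive_coeffs a n) = PS_derive (fun n => Cmod (a n)) n.
Proof.
  unfold derive_coeffs, PS_derive. rewrite Cmod_mult, Cmod_R, Rabs_pos_eq by apply pos_INR.
  reflexivity.
Qed.

Lemma derive_coeffs_abs a h rho :
  disk_series a h -> 0 <= rho < 1 -> abs_summable rho (derive_coeffs a).
Proof.
  intros Hh Hr. assert (H := disk_series_radius a h rho Hh Hr).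
  rewrite <- CV_radius_derive in H. apply CV_disk_inside in H.
  revert H. apply ex_series_ext. intros n. rewrite Cmod_derive_coeffs.
  apply Rabs_pos_eq, Rmult_le_pos; [| apply pow_le, Hr].
  unfold PS_derive. apply Rmult_le_pos; [apply pos_INR | apply Cmod_ge_0].
Qed.

(** The second-order Taylor bound, by induction from the product rule. *)
Lemma pow_taylor2 (R0 : R) (w z : C) (n : nat) :
  Cmod w <= R0 -> Cmod z <= R0 ->
  Cmod (w ^ S (S n) - z ^ S (S n) - RtoC (INR (S (S n))) * z ^ S n * (w - z))
  <= INR (S n) * INR (S (S n)) * R0 ^ n * Cmod (w - z) ^ 2.
Proof.
  intros Hw Hz. assert (HR : 0 <= R0) by (generalize (Cmod_ge_0 w); lra).
  assert (Hd := pow2_ge_0 (Cmod (w - z))).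
  induction n as [|n IH].
  - replace (w ^ 2 - z ^ 2 - RtoC (INR 2) * z ^ 1 * (w - z))%C with ((w - z) * (w - z))%C
      by (simpl; rewrite RtoC_plus; ring).
    rewrite Cmod_mult. change (INR 1) with 1. change (INR 2) with 2. rewrite pow_O. nra.
  - replace (w ^ S (S (S n)) - z ^ S (S (S n)) - RtoC (INR (S (S (S n)))) * z ^ S (S n) * (w - z))%C
      with (w * (w ^ S (S n) - z ^ S (S n) - RtoC (INR (S (S n))) * z ^ S n * (w - z))
            + RtoC (INR (S (S n))) * z ^ S n * ((w - z) * (w - z)))%C
      by (rewrite (S_INR (S (S n))), RtoC_plus, !Cpow_S; ring).
    eapply Rle_trans; [apply Cmod_triangle |].
    rewrite Cmod_mult.
    rewrite (Cmod_mult (RtoC (INR (S (S n))) * z ^ S n)), (Cmod_mult (RtoC (INR (S (S n))))).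
    rewrite (Cmod_mult (w - z)), Cmod_pow, Cmod_R, Rabs_pos_eq by apply pos_INR.
    assert (Hp : Cmod z ^ S n <= R0 ^ S n) by (apply pow_incr; split; [apply Cmod_ge_0 | exact Hz]).
    assert (HRn : 0 <= R0 ^ S n) by (apply pow_le, HR).
    set (m := INR (S n)) in *.
    assert (Hm : 0 <= m) by apply pos_INR.
    replace (INR (S (S (S n)))) with (m + 2) by (unfold m; rewrite !S_INR; ring).
    replace (INR (S (S n))) with (m + 1) in * by (unfold m; rewrite !S_INR; ring).
    set (D := Cmod (w - z)) in *.
    set (Q := Cmod (w ^ S (S n) - z ^ S (S n) - RtoC (m + 1) * z ^ S n * (w - z))) in *.
    assert (H1 : Cmod w * Q <= R0 * (m * (m + 1) * R0 ^ n * D ^ 2)).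
    { apply Rmult_le_compat; [apply Cmod_ge_0 | apply Cmod_ge_0 | exact Hw | exact IH]. }
    assert (H2 : (m + 1) * Cmod z ^ S n * (D * D) <= (m + 1) * R0 ^ S n * (D * D)).
    { apply Rmult_le_compat_r; [nra |]. apply Rmult_le_compat_l; lra. }
    assert (H3 : 0 <= (m + 1) * R0 ^ S n * D ^ 2) by (apply Rmult_le_pos; [apply Rmult_le_pos; lra | exact Hd]).
    simpl pow in *. lra.
Qed.

(** A remainder that is quadratic near [z] is negligible against [w - z]. *)
Lemma is_derive_of_quadratic (h : C -> C) (z d : C) (delta K : R) :
  0 < delta -> 0 <= K ->
  (forall w, Cmod (w - z) < delta ->
     Cmod (h w - h z - (w - z) * d) <= K * Cmod (w - z) ^ 2) ->
  @is_derive C_AbsRing C_NormedModule h z d.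
Proof.
  intros Hd HK H. split; [apply is_linear_scal_l |].
  intros x Hx.
  apply (@is_filter_lim_locally_unique C_AbsRing (AbsRing_NormedModule C_AbsRing)) in Hx. subst x.
  intros eps.
  assert (Hm : 0 < Rmin delta (eps / (K + 1))).
  { apply Rmin_glb_lt; [exact Hd |]. apply Rdiv_lt_0_compat; [apply cond_pos | lra]. }
  exists (mkposreal _ Hm).
  intros w Hw. change (Cmod (w - z) < Rmin delta (eps / (K + 1))) in Hw.
  change (Cmod (h w - h z - (w - z) * d) <= eps * Cmod (w - z)).
  assert (H1 := Rmin_l delta (eps / (K + 1))). assert (H2 := Rmin_r delta (eps / (K + 1))).
  eapply Rle_trans; [apply H; lra |].
  assert (H0 := Cmod_ge_0 (w - z)).
  assert (H3 : Cmod (w - z) * (K + 1) <= eps).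
  { apply Rle_trans with (eps / (K + 1) * (K + 1)).
    - apply Rmult_le_compat_r; lra.
    - right. field. lra. }
  nra.
Qed.

Lemma disk_series_derive a h z :
  disk_series a h -> Cmod z < 1 ->
  exists d, Cseries (fun n => derive_coeffs a n * z ^ n)%C d /\
            @is_derive C_AbsRing C_NormedModule h z d.
Proof.
  intros Hh Hz. assert (Hz0 := Cmod_ge_0 z).
  destruct (ex_Cseries_bound (fun n => derive_coeffs a n * z ^ n)%C
              (fun n => Cmod (derive_coeffs a n) * Cmod z ^ n)) as [d Hd].
  { intros k. rewrite Cmod_mult, Cmod_pow. lra. }
  { apply derive_coeffs_abs with h; [exact Hh | lra]. }
  exists d. split; [exact Hd |].
  (* An intermediate radius, so that the twice differentiated series of moduli still converges there. *)
  set (R0 := (1 + Cmod z) / 2).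
  set (B := fun n => PS_derive (PS_derive (fun n => Cmod (a n))) n * R0 ^ n).
  assert (HR0 : 0 <= R0 < 1) by (unfold R0; lra).
  assert (HB0 : forall n, 0 <= B n).
  { intros n. unfold B, PS_derive. repeat apply Rmult_le_pos; try apply pos_INR.
    - apply Cmod_ge_0.
    - apply pow_le, HR0. }
  assert (HB : ex_series B).
  { assert (H := disk_series_radius a h R0 Hh HR0).
    rewrite <- CV_radius_derive, <- CV_radius_derive in H. apply CV_disk_inside in H.
    revert H. apply ex_series_ext. intros n. apply Rabs_pos_eq, HB0. }
  apply (is_derive_of_quadratic h z d ((1 - Cmod z) / 2) (Series B)); [lra | |].
  { eapply Rle_trans; [apply (HB0 0%nat) |].
    rewrite <- (sum_O B). apply sum_n_le_Series; assumption. }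
  intros w Hw.
  assert (HwR : Cmod w <= R0).
  { assert (T := Cmod_triangle (w - z) z). replace (w - z + z)%C with w in T by ring.
    unfold R0; lra. }
  assert (H1 := Cseries_incr _ _ 1 (Hh w ltac:(lra))).
  assert (H2 := Cseries_incr _ _ 1 (Hh z Hz)).
  assert (H3 := Cseries_incr _ _ 0 Hd).
  rewrite Csum_S, Csum_0 in H1, H2. rewrite Csum_0 in H3.
  assert (H4 := is_series_plus _ _ _ _ (is_series_plus _ _ _ _ H1 (Cseries_scal (-1) _ _ H2))
                  (Cseries_scal (- (w - z)) _ _ H3)).
  rewrite Rmult_comm, <- Series_scal_l.
  match type of H4 with is_series ?u ?l => assert (H5 : Cseries u l) by exact H4; clear H4;
    replace (h w - h z - (w - z) * d)%C with (l : C) end.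
  2:{ match goal with |- (plus (plus ?x ?y) ?w = ?v) => change ((x + y + w)%C = v) end.
      unfold derive_coeffs. simpl. ring. }
  refine (Cseries_Cmod_le _ _ _ _ _ H5).
  2: { exact (ex_series_scal_l (Cmod (w - z) ^ 2) B HB). }
  intros k.
  match goal with |- (Cmod (plus (plus ?x ?y) ?w) <= ?v) => change (Cmod (x + y + w)%C <= v) end.
  change (2 + k)%nat with (S (S k)). change (1 + k)%nat with (S k).
  unfold derive_coeffs.
  replace (a (S (S k)) * w ^ S (S k) + -1 * (a (S (S k)) * z ^ S (S k))
            + - (w - z) * (RtoC (INR (S (S k))) * a (S (S k)) * z ^ S k))%C
    with (a (S (S k)) * (w ^ S (S k) - z ^ S (S k) - RtoC (INR (S (S k))) * z ^ S k * (w - z)))%C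
    by ring.
  rewrite Cmod_mult.
  assert (HT := pow_taylor2 R0 w z k HwR ltac:(unfold R0; lra)).
  eapply Rle_trans; [apply Rmult_le_compat_l; [apply Cmod_ge_0 | exact HT] |].
  unfold B, PS_derive. right. ring.
Qed.

Lemma C_derive_power_sum a h rho :
  disk_series a h -> rho < 1 -> power_sum_on rho (derive_coeffs a) (C_derive h).
Proof.
  intros Hh Hr z Hz. destruct (disk_series_derive a h z Hh ltac:(lra)) as [d [Hd Hder]].
  rewrite (is_C_derive_unique h z d Hder). exact Hd.
Qed.

(** * Comparison of coefficients under domination of derivatives *)

Lemma unit_radius (u : nat -> R) :
  (forall s, 0 <= s < 1 -> ex_series (fun n => u n * s ^ n)) ->
  forall x, 0 <= x < 1 -> Rbar_lt (Rabs x) (CV_radius u).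
Proof.
  intros H x Hx. rewrite Rabs_pos_eq by lra.
  set (s := (1 + x) / 2).
  apply Rbar_lt_le_trans with s; [simpl; unfold s; lra |].
  apply (proj1 (CV_radius_bounded u)).
  destruct (@filterlim_bounded R_AbsRing R_NormedModule (fun n => u n * s ^ n)) as [M HM].
  { exists 0. apply ex_series_lim_0, H. unfold s; lra. }
  exists M. exact HM.
Qed.

Lemma PSeries_ge_of_derive_ge_0 (u : nat -> R) :
  (forall x, 0 <= x < 1 -> Rbar_lt (Rabs x) (CV_radius u)) ->
  (forall x, 0 <= x < 1 -> 0 <= PSeries (PS_derive u) x) ->
  forall x, 0 <= x < 1 -> u 0%nat <= PSeries u x.
Proof.
  intros Hu Hd x Hx.
  destruct (MVT_gen (PSeries u) 0 x (PSeries (PS_derive u))) as [c [Hc E]].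
  - intros y Hy. rewrite Rmin_left, Rmax_right in Hy by lra.
    apply is_derive_PSeries, Hu. lra.
  - intros y Hy. rewrite Rmin_left, Rmax_right in Hy by lra.
    apply PSeries_continuity, Hu. lra.
  - rewrite Rmin_left, Rmax_right in Hc by lra. rewrite PSeries_0 in E.
    specialize (Hd c ltac:(lra)). nra.
Qed.

(** The series with coefficients [n ^ 2 * e n] is obtained from that of [e] by applying twice
    the operator [x d/dx]; each application is undone by integrating from 0, which preserves sign. *)
Lemma weighted_series_ge_0 (e : nat -> R) :
  e 0%nat = 0 ->
  (forall s, 0 <= s < 1 -> ex_series (fun n => e n * s ^ n)) ->
  (forall x, 0 <= x < 1 -> 0 <= Series (fun n => INR (S n) ^ 2 * e (S n) * x ^ n)) ->
  forall x, 0 <= x < 1 -> 0 <= PSeries e x.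
Proof.
  intros He0 He H x Hx. assert (Hr := unit_radius e He).
  set (e1 := PS_incr_1 (PS_derive e)).
  assert (H1 : forall x, 0 <= x < 1 -> 0 <= PSeries e1 x).
  { intros y Hy. change 0 with (e1 0%nat). apply PSeries_ge_of_derive_ge_0; [| | exact Hy].
    - intros s Hs. unfold e1. rewrite CV_radius_incr_1, CV_radius_derive. apply Hr, Hs.
    - intros s Hs. specialize (H s Hs). unfold PSeries.
      erewrite Series_ext; [exact H |]. intros n.
      change (INR (S n) * (INR (S n) * e (S n)) * s ^ n = INR (S n) ^ 2 * e (S n) * s ^ n). ring. }
  rewrite <- He0. apply PSeries_ge_of_derive_ge_0; [exact Hr | | exact Hx].
  (* Dividing by y fails at 0, where the hypothesis itself gives the sign of e 1. *)
  intros y Hy. destruct (Req_dec y 0) as [-> | Hy0].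
  - specialize (H 0 Hy). change (0 <= PSeries (fun n => INR (S n) ^ 2 * e (S n)) 0) in H.
    rewrite PSeries_0 in H |- *. unfold PS_derive. simpl INR in *. lra.
  - specialize (H1 y Hy). unfold e1 in H1. rewrite PSeries_incr_1 in H1.
    apply Rmult_le_reg_l with y; lra.
Qed.

(** The pointwise bound on derivatives gives, on every circle of radius [sqrt x], that the series
    of [(n + 1) ^ 2 (|a (n + 1)| ^ 2 - |b (n + 1)| ^ 2) x ^ n] is nonnegative; the weights are then removed by
    integration in [x]. *)
Lemma dominated_coeffs a b h g r :
  disk_series a h -> disk_series b g ->
  (forall z, Cmod z < 1 -> Cmod (C_derive g z) <= Cmod (C_derive h z)) -> 0 <= r < 1 ->
  Series (fun k => Cmod (b (S k)) ^ 2 * r ^ (2 * S k))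
  <= Series (fun k => Cmod (a (S k)) ^ 2 * r ^ (2 * S k)).
Proof.
  intros Hh Hg Hd Hr.
  assert (HD : forall x, 0 <= x < 1 ->
    Series (fun n => Cmod (derive_coeffs b n) ^ 2 * x ^ (2 * n))
    <= Series (fun n => Cmod (derive_coeffs a n) ^ 2 * x ^ (2 * n))).
  { intros x Hx.
    rewrite <- (Rmult_1_l (Series (fun n => Cmod (derive_coeffs a n) ^ 2 * x ^ (2 * n)))).
    apply parseval_le with (C_derive g) (C_derive h); try lra.
    - apply derive_coeffs_abs with g; assumption.
    - apply C_derive_power_sum; [assumption | lra].
    - apply derive_coeffs_abs with h; assumption.
    - apply C_derive_power_sum; [assumption | lra].
    - intros z Hz. rewrite Rmult_1_l. apply pow_incr. split; [apply Cmod_ge_0 |].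
      apply Hd. lra. }
  assert (Hsq : forall c f s, disk_series c f -> 0 <= s < 1 -> ex_series (fun n => Cmod (c n) ^ 2 * s ^ n)).
  { intros c f s Hc Hs.
    assert (Hq : 0 <= sqrt s < 1).
    { split; [apply sqrt_pos |]. rewrite <- sqrt_1. apply sqrt_lt_1; lra. }
    assert (H := abs_summable_sqr (sqrt s) c (proj1 Hq) (disk_series_abs c f _ Hc Hq)).
    revert H. apply ex_series_ext. intros n.
    rewrite pow_mult, pow2_sqrt by lra. reflexivity. }
  set (e := fun n => match n with O => 0 | S _ => Cmod (a n) ^ 2 - Cmod (b n) ^ 2 end).
  assert (He : forall s, 0 <= s < 1 -> ex_series (fun n => e n * s ^ n)).
  { intros s Hs. apply (proj2 (ex_series_incr_1 (fun n => e n * s ^ n))).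
    assert (H1 := proj1 (ex_series_incr_1 _) (Hsq a h s Hh Hs)).
    assert (H2 := proj1 (ex_series_incr_1 _) (Hsq b g s Hg Hs)).
    generalize (ex_series_minus _ _ H1 H2). apply ex_series_ext. intros n.
    change (Cmod (a (S n)) ^ 2 * s ^ S n - Cmod (b (S n)) ^ 2 * s ^ S n = e (S n) * s ^ S n).
    unfold e. ring. }
  assert (Hsh : forall c f s, disk_series c f -> 0 <= s < 1 ->
    ex_series (fun k => Cmod (c (S k)) ^ 2 * s ^ (2 * S k))).
  { intros c f s Hc Hs.
    apply (proj1 (ex_series_incr_1 (fun k => Cmod (c k) ^ 2 * s ^ (2 * k)))).
    apply abs_summable_sqr; [lra | apply disk_series_abs with f; assumption]. }
  assert (HF : 0 <= PSeries e (r ^ 2)).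
  { apply weighted_series_ge_0; [reflexivity | exact He | | split; nra].
    intros x Hx.
    assert (Hq : 0 <= sqrt x < 1).
    { split; [apply sqrt_pos |]. rewrite <- sqrt_1. apply sqrt_lt_1; lra. }
    specialize (HD _ Hq).
    rewrite (Series_ext (fun n => INR (S n) ^ 2 * e (S n) * x ^ n)
      (fun n => Cmod (derive_coeffs a n) ^ 2 * sqrt x ^ (2 * n)
                - Cmod (derive_coeffs b n) ^ 2 * sqrt x ^ (2 * n))).
    - rewrite Series_minus; [lra | |];
      (apply abs_summable_sqr; [lra |]); eapply derive_coeffs_abs; eassumption.
    - intros n. rewrite pow_mult, pow2_sqrt by lra.
      unfold derive_coeffs, e. rewrite !Cmod_mult, Cmod_R, Rabs_pos_eq by apply pos_INR. ring. }
  unfold PSeries in HF. rewrite Series_incr_1 in HF by (apply He; split; nra).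
  assert (E : Series (fun k => e (S k) * (r ^ 2) ^ S k)
    = Series (fun k => Cmod (a (S k)) ^ 2 * r ^ (2 * S k)) - Series (fun k => Cmod (b (S k)) ^ 2 * r ^ (2 * S k))).
  { rewrite <- Series_minus by (eapply Hsh; eassumption).
    apply Series_ext. intros k. rewrite pow_mult. unfold e. ring. }
  simpl e in HF at 1. rewrite E in HF. lra.
Qed.

(** * The critical radius *)

Lemma sqrt5_sqr : sqrt 5 * sqrt 5 = 5.
Proof. apply sqrt_sqrt; lra. Qed.

Lemma sqrt5_bounds : 2.23606775 <= sqrt 5 <= 2.23606825.
Proof.
  assert (H := sqrt5_sqr). assert (H0 := sqrt_pos 5).
  split; apply Rnot_lt_le; intros L; nra.
Qed.

Lemma r0_eq : r0 = 5 - 2 * sqrt 5.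
Proof.
  assert (H := sqrt5_sqr). assert (Hb := sqrt5_bounds). unfold r0.
  replace (5 / (9 + 4 * sqrt 5)) with ((5 - 2 * sqrt 5) ^ 2).
  - apply sqrt_pow2. lra.
  - apply Rmult_eq_reg_r with (9 + 4 * sqrt 5); [| lra].
    replace (5 / (9 + 4 * sqrt 5) * (9 + 4 * sqrt 5)) with 5 by (field; lra).
    transitivity (225 - 80 * sqrt 5 - 44 * (sqrt 5 * sqrt 5) + 16 * (sqrt 5 * sqrt 5) * sqrt 5);
      [ring |].
    rewrite H. ring.
Qed.

(** At [r = r0] the cubic has a double root at [sqrt 5 - 2]; this is what singles out [r0], and
    the corresponding value [|a 0| = (sqrt 5 - 2) / r0] is [/ sqrt 5]. *)
Lemma cubic_factor (t : R) :
  1 - t + 2 * t ^ 2 + 2 * t ^ 3 - r0 ^ 2 * (3 + t)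
  = 2 * (t - (sqrt 5 - 2)) ^ 2 * (t + (2 * sqrt 5 - 3)).
Proof.
  assert (H := sqrt5_sqr). rewrite r0_eq.
  set (s := sqrt 5) in *.
  assert (E2 : s ^ 2 = 5) by (rewrite <- H; ring).
  assert (E3 : s ^ 3 = 5 * s) by (replace (s ^ 3) with (s * s * s) by ring; rewrite H; ring).
  ring_simplify. rewrite E3, E2. ring.
Qed.

Lemma cubic_ge_0 (r t : R) : 0 <= r <= r0 -> 0 <= t ->
  0 <= 1 - t + 2 * t ^ 2 + 2 * t ^ 3 - r ^ 2 * (3 + t).
Proof.
  intros Hr Ht. assert (Hb := sqrt5_bounds).
  apply Rle_trans with (1 - t + 2 * t ^ 2 + 2 * t ^ 3 - r0 ^ 2 * (3 + t)).
  - rewrite cubic_factor. apply Rmult_le_pos; [| lra].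
    apply Rmult_le_pos; [lra | apply pow2_ge_0].
  - assert (r ^ 2 <= r0 ^ 2) by (apply pow_incr; lra). nra.
Qed.

(** The bound on [y] amounts to
    [1 - y ^ 2 >= (1 - al ^ 2) (1 - r ^ 2) / (1 + t) ^ 2] with [t = al * r]. Inserting both bounds, a factor
    [1 - al ^ 2] splits off and leaves the cubic in [t] of [cubic_ge_0]. *)
Lemma extremal_inequality (al r y S : R) :
  0 <= al <= 1 -> 0 <= r <= r0 -> 0 <= y ->
  y * (1 + al * r) <= al + r ->
  (1 - al ^ 2 * r ^ 2) * S <= r ^ 2 * (1 - al ^ 2) ^ 2 ->
  y ^ 2 + 2 * S <= 1.
Proof.
  intros Hal Hr Hy H1 H2.
  assert (Hr1 : r < 1) by (rewrite r0_eq in Hr; generalize sqrt5_bounds; lra).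
  set (t := al * r) in *.
  assert (Ht : 0 <= t < 1) by (unfold t; nra).
  assert (Hc := cubic_ge_0 r t Hr (proj1 Ht)).
  assert (H1' : (y * (1 + t)) ^ 2 <= (al + r) ^ 2) by (apply pow_incr; nra).
  assert (E1 : (1 + t) ^ 2 - (al + r) ^ 2 = (1 - al ^ 2) * (1 - r ^ 2)) by (unfold t; ring).
  assert (H2' : (1 + t) * (1 - t) * S <= r ^ 2 * (1 - al ^ 2) ^ 2)
    by (replace ((1 + t) * (1 - t)) with (1 - al ^ 2 * r ^ 2) by (unfold t; ring); exact H2).
  assert (E2 : (1 - t) * ((1 - al ^ 2) * (1 - r ^ 2)) - 2 * (1 + t) * (r ^ 2 * (1 - al ^ 2) ^ 2)
     = (1 - al ^ 2) * (1 - t + 2 * t ^ 2 + 2 * t ^ 3 - r ^ 2 * (3 + t))) by (unfold t; ring).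
  assert (Ha : 0 <= 1 - al ^ 2) by nra.
  assert (H3 := Rmult_le_pos _ _ Ha Hc). rewrite <- E2 in H3.
  assert (H4 : (1 - t) * (y * (1 + t)) ^ 2 <= (1 - t) * (al + r) ^ 2)
    by (apply Rmult_le_compat_l; lra).
  assert (H5 : (1 + t) * ((1 + t) * (1 - t) * S) <= (1 + t) * (r ^ 2 * (1 - al ^ 2) ^ 2))
    by (apply Rmult_le_compat_l; lra).
  assert (H6 : 0 < (1 - t) * (1 + t) ^ 2) by (apply Rmult_lt_0_compat; nra).
  apply Rmult_le_reg_l with ((1 - t) * (1 + t) ^ 2); [exact H6 |].
  assert (E3 : (al + r) ^ 2 = (1 + t) ^ 2 - (1 - al ^ 2) * (1 - r ^ 2)) by lra.
  rewrite E3 in H4. lra.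
Qed.

(** * The inequality *)

Lemma sup_norm_le_1 h : sup_norm h = Finite 1 -> forall w, Cmod w < 1 -> Cmod (h w) <= 1.
Proof.
  intros H w Hw.
  destruct (Lub_Rbar_correct (fun x : R => exists z : C, unit_disk z /\ x = Cmod (h z))) as [Hub _].
  unfold sup_norm in H. rewrite H in Hub.
  apply (Hub (Cmod (h w))). exists w. split; [exact Hw | reflexivity].
Qed.

Lemma disk_series_at_0 a h : disk_series a h -> h (RtoC 0) = a 0%nat.
Proof.
  intros Hh. apply (Cseries_unique (fun n => a n * RtoC 0 ^ n)%C).
  - apply Hh. rewrite Cmod_0. lra.
  - generalize (Cseries_single 0 (a 0%nat)). apply Cseries_ext.
    intros n. destruct n as [|n]; simpl; ring.
Qed.

(** The series of [g] starts at exponent 1, so its constant coefficient is set to 0. *)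
Definition drop_constant (b : nat -> C) (n : nat) : C :=
  match n with O => RtoC 0 | S _ => b n end.

Lemma Cseries_decr (c : nat -> C) (l : C) :
  Cseries (fun k => c (S k)) l -> Cseries c (l + c 0%nat)%C.
Proof.
  intros H. apply is_series_decr_1.
  change (Cseries (fun k => c (S k)) (l + c 0%nat + - c 0%nat)%C).
  replace (l + c 0%nat + - c 0%nat)%C with l by ring. exact H.
Qed.

Lemma drop_constant_disk_series b g :
  (forall z, Cmod z < 1 -> Cseries (fun k => b (S k) * z ^ (S k))%C (g z)) ->
  disk_series (drop_constant b) g.
Proof.
  intros H z Hz.
  replace (g z) with (g z + drop_constant b 0 * z ^ 0)%C by (simpl; ring).
  apply (Cseries_decr (fun n => drop_constant b n * z ^ n)%C), (H z Hz).
Qed.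

Lemma ex_shifted_sqr c F r : disk_series c F -> 0 <= r < 1 ->
  ex_series (fun k => Cmod (c (S k)) ^ 2 * r ^ (2 * S k)).
Proof.
  intros Hc Hr. apply (proj1 (ex_series_incr_1 (fun k => Cmod (c k) ^ 2 * r ^ (2 * k)))).
  apply abs_summable_sqr; [lra | apply disk_series_abs with F; assumption].
Qed.

Lemma bohr_inequality (f h g : C -> C) (a b : nat -> C) (z : C) :
  admissible f h g a b -> Cmod z < 1 -> Cmod z <= r0 ->
  ex_series (coeff_term a b (Cmod z)) /\
  Cmod (h z) ^ 2 + Series (coeff_term a b (Cmod z)) <= 1.
Proof.
  intros [[_ [_ Hs]] [Hsup Hd]] Hz Hz0. set (r := Cmod z) in *.
  assert (Hr : 0 <= r < 1) by (split; [apply Cmod_ge_0 | exact Hz]).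
  assert (Hh : disk_series a h) by (intros w Hw; apply (Hs w Hw)).
  assert (Hg : disk_series (drop_constant b) g)
    by (apply drop_constant_disk_series; intros w Hw; apply (Hs w Hw)).
  assert (Hb := sup_norm_le_1 h Hsup).
  assert (Ha := ex_shifted_sqr a h r Hh Hr).
  assert (Hb' := ex_shifted_sqr (drop_constant b) g r Hg Hr).
  assert (E : forall k, Cmod (a (S k)) ^ 2 * r ^ (2 * S k)
      + Cmod (drop_constant b (S k)) ^ 2 * r ^ (2 * S k) = coeff_term a b r k)
    by (intros k; unfold coeff_term, drop_constant; ring).
  split.
  - exact (ex_series_ext _ _ E (ex_series_plus _ _ Ha Hb')).
  - rewrite <- (Series_ext _ _ E), Series_plus by assumption.
    assert (Hdom := dominated_coeffs a (drop_constant b) h g r Hh Hg Hd Hr).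
    assert (Ha0 : Cmod (a 0%nat) <= 1).
    { rewrite <- (disk_series_at_0 a h Hh). apply Hb. rewrite Cmod_0. lra. }
    assert (HE := extremal_inequality (Cmod (a 0%nat)) r (Cmod (h z)) _
      (conj (Cmod_ge_0 _) Ha0) ltac:(lra) (Cmod_ge_0 _)
      (growth_bound a h z Hh Hb Hz Ha0) (coeff_sum_bound a h r Hh Hb Hr)).
    lra.
Qed.

(** * The equation for the radius *)

Lemma Rpower_3_2 x : 0 < x -> Rpower x (3 / 2) = x * sqrt x.
Proof.
  intros Hx. replace (3 / 2) with (1 + / 2) by field.
  rewrite Rpower_plus, Rpower_1, Rpower_sqrt by exact Hx. reflexivity.
Qed.

Lemma radius_equation_r0 : radius_equation r0.
Proof.
  assert (H := sqrt5_sqr). assert (Hb := sqrt5_bounds).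
  unfold radius_equation. rewrite r0_eq.
  replace (10 + 6 * (5 - 2 * sqrt 5) ^ 2) with ((6 * sqrt 5 - 10) ^ 2) by nra.
  rewrite Rpower_3_2, sqrt_pow2 by nra.
  set (s := sqrt 5) in *. nra.
Qed.

(** The left-hand side of the equation increases on the positive axis, whence at most one root. *)
Lemma radius_equation_increasing r r' : 0 < r < r' ->
  Rpower (10 + 6 * r ^ 2) (3 / 2) + 144 * r ^ 2 - 80
  < Rpower (10 + 6 * r' ^ 2) (3 / 2) + 144 * r' ^ 2 - 80.
Proof.
  intros Hr. assert (r ^ 2 < r' ^ 2) by nra.
  assert (Rpower (10 + 6 * r ^ 2) (3 / 2) < Rpower (10 + 6 * r' ^ 2) (3 / 2)).
  { apply Rlt_Rpower_l; [lra |]. generalize (pow2_ge_0 r); lra. }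
  lra.
Qed.

Lemma r0_unique_root : unique (fun r : R => (0 < r < 1 / sqrt 2) /\ radius_equation r) r0.
Proof.
  assert (Hb := sqrt5_bounds). split.
  - split; [| apply radius_equation_r0]. rewrite r0_eq. split; [lra |].
    assert (H2 := sqrt_sqrt 2 ltac:(lra)). assert (Hp : 0 < sqrt 2) by (apply sqrt_lt_R0; lra).
    apply Rmult_lt_reg_r with (sqrt 2); [exact Hp |].
    replace (1 / sqrt 2 * sqrt 2) with 1 by (field; lra).
    assert (sqrt 2 < 1.5) by (apply Rnot_le_lt; intros L; nra). nra.
  - intros r [Hr E]. assert (E0 := radius_equation_r0).
    unfold radius_equation in E, E0.
    assert (0 < r0) by (rewrite r0_eq; lra).
    destruct (Rtotal_order r0 r) as [L | [L | L]]; [| exact L |];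
      exfalso; [assert (I := radius_equation_increasing r0 r) | assert (I := radius_equation_increasing r r0)]; lra.
Qed.

(** * Sharpness *)

(** The disk automorphism that sends 0 to [al] makes every inequality of the first part an equality,
    at positive [z], when [g] is taken to be [h - al]. *)
Section Extremal.
Variable al : R.
Hypothesis Hal : 0 < al < 1.

Definition moebius (z : C) : C := ((RtoC al + z) / (1 + RtoC al * z))%C.

Definition moebius_coeffs (n : nat) : C :=
  match n with O => RtoC al | S k => RtoC ((1 - al ^ 2) * (- al) ^ k) end.

Lemma moebius_den z : Cmod z < 1 -> (1 + RtoC al * z)%C <> RtoC 0.
Proof.
  intros Hz. replace (1 + RtoC al * z)%C with (1 - RtoC (- al) * z)%C
    by (rewrite RtoC_opp; ring).
  apply one_minus_neq_0. rewrite Cmod_mult, Cmod_R, Rabs_Ropp, Rabs_pos_eq by lra.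
  generalize (Cmod_ge_0 z); nra.
Qed.

Lemma moebius_tail z : Cmod z < 1 ->
  Cseries (fun k => moebius_coeffs (S k) * z ^ S k)%C (moebius z - RtoC al)%C.
Proof.
  intros Hz. assert (Hd := moebius_den z Hz).
  assert (Hq : Cmod (RtoC (- al) * z) < 1).
  { rewrite Cmod_mult, Cmod_R, Rabs_Ropp, Rabs_pos_eq by lra. generalize (Cmod_ge_0 z); nra. }
  assert (H := Cseries_scal (RtoC (1 - al ^ 2) * z) _ _ (Cseries_geom _ Hq)).
  replace (moebius z - RtoC al)%C with (RtoC (1 - al ^ 2) * z * / (1 - RtoC (- al) * z))%C.
  - revert H. apply Cseries_ext. intros n. unfold moebius_coeffs.
    rewrite Cpow_mult_l, RtoC_mult, <- RtoC_pow, Cpow_S. ring.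
  - unfold moebius. rewrite RtoC_opp, RtoC_minus, RtoC_pow. field. exact Hd.
Qed.

Lemma moebius_series : disk_series moebius_coeffs moebius.
Proof.
  intros z Hz. assert (H := Cseries_decr (fun n => moebius_coeffs n * z ^ n)%C _ (moebius_tail z Hz)).
  simpl in H. replace (moebius z) with (moebius z - RtoC al + RtoC al * 1)%C by ring. exact H.
Qed.

Lemma moebius_derive_eq z : Cmod z < 1 ->
  C_derive (fun w => moebius w - RtoC al)%C z = C_derive moebius z.
Proof.
  intros Hz.
  assert (Hg := drop_constant_disk_series _ _ moebius_tail).
  destruct (disk_series_derive _ _ z moebius_series Hz) as [d [Sd Hd]].
  destruct (disk_series_derive _ _ z Hg Hz) as [d' [Sd' Hd']].
  rewrite (is_C_derive_unique _ _ _ Hd), (is_C_derive_unique _ _ _ Hd').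
  exact (Cseries_unique _ _ _ Sd' Sd).
Qed.

Lemma moebius_le_1 z : Cmod z < 1 -> Cmod (moebius z) <= 1.
Proof.
  intros Hz. assert (Hd := moebius_den z Hz).
  unfold moebius. rewrite Cmod_div by exact Hd.
  assert (Hp := proj1 (Cmod_gt_0 _) Hd).
  apply Rmult_le_reg_r with (Cmod (1 + RtoC al * z)); [exact Hp |].
  replace (Cmod (RtoC al + z) / Cmod (1 + RtoC al * z) * Cmod (1 + RtoC al * z))
    with (Cmod (RtoC al + z)) by (field; lra).
  assert (H := Cmod_blaschke (RtoC (- al)) z).
  replace (1 - Cconj (RtoC (- al)) * z)%C with (1 + RtoC al * z)%C in H
    by (apply injective_projections; simpl; ring).
  replace (z - RtoC (- al))%C with (RtoC al + z)%C in H by (rewrite RtoC_opp; ring).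
  rewrite Cmod_R, pow2_abs in H.
  assert (0 <= (1 - (- al) ^ 2) * (1 - Cmod z ^ 2)).
  { generalize (Cmod_ge_0 z); intros. apply Rmult_le_pos; nra. }
  apply Rnot_lt_le; intros L. assert (H1 := Cmod_ge_0 (RtoC al + z)). nra.
Qed.

Lemma moebius_real (x : R) : 0 <= x -> moebius (RtoC x) = RtoC ((al + x) / (1 + al * x)).
Proof.
  intros Hx. unfold moebius. rewrite RtoC_div by nra.
  rewrite !RtoC_plus, RtoC_mult. reflexivity.
Qed.

Lemma moebius_sup_norm : sup_norm moebius = Finite 1.
Proof.
  apply is_lub_Rbar_unique. split.
  - intros x [z [Hz ->]]. apply moebius_le_1, Hz.
  - intros b Hb.
    assert (H : forall x, 0 <= x < 1 -> Rbar_le x b).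
    { intros x Hx. apply Rbar_le_trans with ((al + x) / (1 + al * x)).
      - simpl. apply Rmult_le_reg_r with (1 + al * x); [nra |].
        replace ((al + x) / (1 + al * x) * (1 + al * x)) with (al + x) by (field; nra).
        assert (al * (x * x) <= al * 1) by (apply Rmult_le_compat_l; nra). lra.
      - apply Hb. exists (RtoC x). split.
        + unfold unit_disk. rewrite Cmod_R, Rabs_pos_eq; lra.
        + rewrite moebius_real, Cmod_R, Rabs_pos_eq; [reflexivity | | lra].
          apply Rdiv_le_0_compat; nra. }
    destruct b as [b | |]; [| exact I | exact (H 0 ltac:(lra))].
    simpl. apply Rnot_lt_le; intros L.
    assert (H0 := H 0 ltac:(lra)). simpl in H0.
    specialize (H ((1 + b) / 2) ltac:(lra)). simpl in H. lra.
Qed.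

Lemma moebius_admissible :
  admissible (fun z => moebius z + Cconj (moebius z - RtoC al))%C
    moebius (fun z => moebius z - RtoC al)%C moebius_coeffs moebius_coeffs.
Proof.
  repeat split.
  - intros z Hz. destruct (disk_series_derive _ _ z moebius_series Hz) as [d [_ Hd]].
    exists d; exact Hd.
  - intros z Hz.
    destruct (disk_series_derive _ _ z (drop_constant_disk_series _ _ moebius_tail) Hz) as [d [_ Hd]].
    exists d; exact Hd.
  - apply moebius_series, H.
  - apply moebius_tail, H.
  - apply moebius_sup_norm.
  - intros z Hz. rewrite moebius_derive_eq by exact Hz. lra.
Qed.

Lemma moebius_coeff_series r : 0 <= r < 1 ->
  is_series (coeff_term moebius_coeffs moebius_coeffs r)
    (2 * (1 - al ^ 2) ^ 2 * r ^ 2 / (1 - al ^ 2 * r ^ 2)).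
Proof.
  intros Hr.
  assert (Hq : Rabs (al ^ 2 * r ^ 2) < 1).
  { rewrite Rabs_pos_eq by nra. assert (al * r < 1) by nra. assert (0 <= al * r) by nra. nra. }
  generalize (is_series_scal_l (2 * (1 - al ^ 2) ^ 2 * r ^ 2) _ _ (is_series_geom _ Hq)).
  apply is_series_ext. intros k.
  change (2 * (1 - al ^ 2) ^ 2 * r ^ 2 * (al ^ 2 * r ^ 2) ^ k
          = coeff_term moebius_coeffs moebius_coeffs r k).
  unfold coeff_term, moebius_coeffs. rewrite Cmod_R, pow2_abs, Rpow_mult_distr, !(pow_mult r).
  replace (((1 - al ^ 2) * (- al) ^ k) ^ 2) with ((1 - al ^ 2) ^ 2 * (al ^ 2) ^ k).
  - simpl. ring.
  - rewrite Rpow_mult_distr, <- !pow_mult, (Nat.mul_comm k 2), !pow_mult.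
    f_equal. f_equal. ring.
Qed.

(** The estimates behind [extremal_inequality] being equalities here, its computation
    becomes an identity. *)
Lemma moebius_value r : 0 <= r < 1 ->
  Cmod (moebius (RtoC r)) ^ 2 + Series (coeff_term moebius_coeffs moebius_coeffs r)
  = 1 - (1 - al ^ 2) / ((1 + al * r) ^ 2 * (1 - al * r))
        * (1 - al * r + 2 * (al * r) ^ 2 + 2 * (al * r) ^ 3 - r ^ 2 * (3 + al * r)).
Proof.
  intros Hr. rewrite (is_series_unique _ _ (moebius_coeff_series r Hr)).
  rewrite moebius_real, Cmod_R, pow2_abs by lra.
  assert (0 <= al * r < 1) by nra. field. split; [nra |]. split; nra.
Qed.

End Extremal.

(** With [al] fixed to its extremal value, [r = sqrt 5 * t] and the expression becomes
    [1 - t - 13 t ^ 2 - 3 t ^ 3], which decreases through its root [sqrt 5 - 2]. *)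
Lemma cubic_lt_0 (r : R) : r0 < r ->
  let t := / sqrt 5 * r in
  1 - t + 2 * t ^ 2 + 2 * t ^ 3 - r ^ 2 * (3 + t) < 0.
Proof.
  intros Hr t. assert (H := sqrt5_sqr). assert (Hb := sqrt5_bounds).
  rewrite r0_eq in Hr.
  assert (Er : r = sqrt 5 * t) by (unfold t; field; lra).
  rewrite Er in Hr |- *. clearbody t. clear Er. set (s := sqrt 5) in *.
  assert (Ht : s - 2 < t) by (apply Rmult_lt_reg_l with s; nra).
  assert (E : 1 - t + 2 * t ^ 2 + 2 * t ^ 3 - (s * t) ^ 2 * (3 + t)
    = - ((t - (s - 2)) * (3 * t ^ 2 + (13 + 3 * (s - 2)) * t + (s + 2)))).
  { replace ((s * t) ^ 2) with (5 * t ^ 2) by (rewrite <- H; ring).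
    assert (E2 : s ^ 2 = 5) by (rewrite <- H; ring).
    ring_simplify. rewrite E2. ring. }
  rewrite E. assert (0 < 3 * t ^ 2 + (13 + 3 * (s - 2)) * t + (s + 2)) by nra. nra.
Qed.

Theorem theorem4 :
  (* the inequality for |z| = r <= r0 *)
  (forall (f h g : C -> C) (a b : nat -> C),
     admissible f h g a b ->
     forall (z : C) (r : R),
       unit_disk z -> Cmod z = r -> r <= r0 ->
       ex_series (coeff_term a b r) /\
       Cmod (h z) ^ 2 + Series (coeff_term a b r) <= 1) /\
  (* r0 is the unique root in (0, 1/sqrt 2), and its numerical value *)
  unique (fun r : R => (0 < r < 1 / sqrt 2) /\ radius_equation r) r0 /\
  Rabs (r0 - 527864 / 1000000) <= 5 / 10000000 /\
  (* r0 cannot be replaced by any larger number *)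
  (forall r1 : R, r0 < r1 ->
     exists (f h g : C -> C) (a b : nat -> C),
       admissible f h g a b /\
       exists (z : C) (r : R),
         unit_disk z /\ Cmod z = r /\ r <= r1 /\
         ex_series (coeff_term a b r) /\
         1 < Cmod (h z) ^ 2 + Series (coeff_term a b r)).
Proof.
  assert (Hs := sqrt5_sqr). assert (Hb := sqrt5_bounds).
  split; [| split; [exact r0_unique_root | split]].
  - intros f h g a b Hadm z r Hz <- Hr. exact (bohr_inequality f h g a b z Hadm Hz Hr).
  - rewrite r0_eq. apply Rabs_le. lra.
  - intros r1 Hr1.
    set (al := / sqrt 5).
    assert (Hal : 0 < al < 1).
    { unfold al. split; [apply Rinv_0_lt_compat; lra |]. rewrite <- Rinv_1.
      apply Rinv_lt_contravar; lra. }
    exists (fun z => moebius al z + Cconj (moebius al z - RtoC al))%C, (moebius al),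
      (fun z => moebius al z - RtoC al)%C, (moebius_coeffs al), (moebius_coeffs al).
    split; [exact (moebius_admissible al Hal) |].
    (* The radius must lie between r0 and r1 but also below 1. *)
    set (r := Rmin r1 ((1 + r0) / 2)).
    assert (H0 : 0 < r0 < 1) by (rewrite r0_eq; lra).
    assert (Hr : r0 < r) by (apply Rmin_glb_lt; lra).
    assert (Hr' : r < 1) by (unfold r; generalize (Rmin_r r1 ((1 + r0) / 2)); lra).
    exists (RtoC r), r.
    assert (Ec : Cmod (RtoC r) = r) by (rewrite Cmod_R, Rabs_pos_eq; lra).
    split; [unfold unit_disk; lra |]. split; [exact Ec |].
    split; [apply Rmin_l |]. split.
    + eexists. apply (moebius_coeff_series al Hal r); lra.
    + rewrite (moebius_value al Hal r) by lra.
      assert (Hn := cubic_lt_0 r Hr). cbv zeta in Hn. fold al in Hn.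
      match goal with |- 1 < 1 - ?k * ?p => assert (Hk : 0 < k); [| nra] end.
      assert (0 <= al * r < 1) by nra.
      apply Rdiv_lt_0_compat; [nra |]. apply Rmult_lt_0_compat; nra.
Qed.
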